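(* Let $(Y,Z)$ be a random vector with $Y\in\mathbb{R}^d$, $Z\in\mathbb{R}^k$, defined on the product probability space $(\Omega,\mathcal{A},\mathrm{P})=(\Omega_0,\mathcal{A}_0,\mathrm{P}_0)\times(\Omega_1,\mathcal{A}_1,\mathrm{P}_1)\times((0,1),\mathcal{B}(0,1),\mathrm{Leb})$ (second factor carrying $(Y,Z)$, first carrying random vectors with law $F_U$, last the unit interval with Lebesgue measure). Assume: (N) $F_U$ has a Lebesgue density on $\mathbb{R}^d$ with convex support $\mathcal{U}$; (C) for each $z$ in the support $\mathcal{Z}$ of $Z$, the conditional distribution $F_{Y\mid Z}(\cdot,z)$ has a Lebesgue density; (M) $\mathrm{E}\|Y\|^2<\infty$ and $\int\|u\|^2F_U(du)<\infty$. Consider the primal problem $$\max_V\{\mathrm{E}(V^\top Y): V\mid Z\sim F_U\},$$ over random vectors $V$ on $(\Omega,\mathcal{A},\mathrm{P})$, and the dual problem $$\min_{(\psi,\varphi)}\ \mathrm{E}(\varphi(V,Z)+\psi(Y,Z))\quad\text{subject to}\quad \varphi(u,z)+\psi(y,z)\ge u^\top y\ \text{ for all } (z,y,u)\in\mathcal{Z}\times\mathbb{R}^{2d},$$ where $V$ is any vector with $V\mid Z\sim F_U$, and the minimization is over Borel maps $\psi,\varphi:\mathbb{R}^d\times\mathcal{Z}\to\mathbb{R}\cup\{+\infty\}$ such that $y\mapsto\psi(y,z)$ and $u\mapsto\varphi(u,z)$ are lower semicontinuous for each $z$. Let $Q_{Y\mid Z}$ and $Q^{-1}_{Y\mid Z}$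 denote the conditional vector quantile and rank functions: for each $z$, $u\mapsto Q_{Y\mid Z}(u,z)$ is the $F_U$-a.e. unique gradient of a convex function pushing $F_U$ to $F_{Y\mid Z}(\cdot,z)$, and $Q^{-1}_{Y\mid Z}(\cdot,z)$ satisfies $Q^{-1}_{Y\mid Z}(Q_{Y\mid Z}(u,z),z)=u$ for $F_U$-a.e. $u$. Then: (a) There exists a pair of maps $(u,z)\mapsto\varphi(u,z)$ and $(y,z)\mapsto\psi(y,z)=\varphi^*(y,z)$ from $\mathbb{R}^d\times\mathcal{Z}$ to $\mathbb{R}$ solving the dual problem; for each $z\in\mathcal{Z}$, $u\mapsto\varphi(u,z)$ and $y\mapsto\varphi^*(y,z)$ are convex and Legendre transforms of each other: $\varphi(u,z)=\sup_{y\in\mathbb{R}^d}\{u^\top y-\varphi^*(y,z)\}$ and $\varphi^*(y,z)=\sup_{u\in\mathbb{R}^d}\{u^\top y-\varphi(u,z)\}$ for all $(u,z)\in\mathcal{UZ}$ and $(y,z)\in\mathcal{YZ}$. (b) For each $z\in\mathcal{Z}$, $Q_{Y\mid Z}(u,z)=\nabla_u\varphi(u,z)$ for $F_U$-almost every $u$. (c) For each $z\in\mathcal{Z}$, $Q^{-1}_{Y\mid Z}(y,z)=\nabla_y\varphi^*(y,z)$ for $F_{Y\mid Z}(\cdot,z)$-almost every $y$. (d) The vector $U=Q^{-1}_{Y\mid Z}(Y,Z)$ solves the primal problem and is unique in the sense that any other solution $U^*$ satisfies $U^*=U$ $\mathrm{P}$-almost surely; the primal and dual problems have the same value. (e) For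 each $z\in\mathcal{Z}$, for $F_U$-a.e. $u$ and $F_{Y\mid Z}(\cdot,z)$-a.e. $y$: $\nabla_y\varphi^*(\nabla_u\varphi(u,z),z)=u$ and $\nabla_u\varphi(\nabla_y\varphi^*(y,z),z)=y$.
   Context: $\mathcal{UZ}$ denotes the support of $F_U\otimes F_Z$ and $\mathcal{YZ}$ the support of the joint law of $(Y,Z)$. $V\mid Z\sim F_U$ means the conditional law of $V$ given $Z$ is $F_U$.
   Formalization: In (a) the maps φ and φ* take values in R∪{+∞} rather than R (finite φ is impossible, e.g., for F_U uniform on a ball and Gaussian Y); the quantile and rank functions Q and Q^{-1} are assumed jointly Borel in both arguments, so that U=Q^{-1}(Y,Z) is a random vector. *)

(* Defs.v *)
From HB Require Import structures.
From mathcomp Require Import all_boot all_order all_algebra.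
From mathcomp Require Import all_classical all_reals all_analysis.
From mathcomp Require Import measurable_realfun.
Set Implicit Arguments.
Unset Strict Implicit.
Unset Printing Implicit Defensive.
Import Order.TTheory GRing.Theory Num.Theory.
Import numFieldNormedType.Exports.
Local Open Scope classical_set_scope.
Local Open Scope ring_scope.

Definition open_rV (R : realType) (n : nat) : set (set 'rV[R]_n) := @open 'rV[R]_n.
Notation Rv R n := (g_sigma_algebraType (@open_rV R n)).

Definition dotv {R : realType} {n : nat} (u y : 'rV[R]_n) : R :=
  \sum_(i < n) u 0 i * y 0 i.
Definition sqnorm {R : realType} {n : nat} (u : 'rV[R]_n) : R :=
  \sum_(i < n) u 0 i ^+ 2.

(** [lam] is Lebesgue measure on R^n: it gives every half-open box its volume.
    (A measure on the Borel sets of R^n with this property exists and is unique.) *)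
Definition is_lebesgue_Rn {R : realType} {n : nat}
    (lam : set (Rv R n) -> \bar R) : Prop :=
  forall a b : 'rV[R]_n, (forall i, a 0 i <= b 0 i) ->
    lam [set x : 'rV[R]_n | forall i, a 0 i <= x 0 i < b 0 i]
      = (\prod_(i < n) (b 0 i - a 0 i))%:E.

Definition has_density {R : realType} {n : nat}
    (lam mu : set (Rv R n) -> \bar R) : Prop :=
  exists f : Rv R n -> \bar R,
    [/\ measurable_fun setT f, (forall x, (0 <= f x)%E) &
        forall A, measurable A -> mu A = (\int[lam]_(x in A) f x)%E].

Definition supp {R : realType} {n : nat} (mu : set (Rv R n) -> \bar R)
  : set 'rV[R]_n :=
  [set x | forall O : set 'rV[R]_n, open O -> O x -> (0 < mu O)%E].

Definition supp2 {R : realType} {n m : nat}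
    (mu : set (Rv R n * Rv R m) -> \bar R) : set ('rV[R]_n * 'rV[R]_m) :=
  [set x | forall O : set ('rV[R]_n * 'rV[R]_m), open O -> O x -> (0 < mu O)%E].

Definition cond_law {R : realType} {dO} {Om : measurableType dO} {n m : nat}
    (P : set Om -> \bar R) (V : Om -> Rv R n) (Z : Om -> Rv R m)
    (K : 'rV[R]_m -> set (Rv R n) -> \bar R) : Prop :=
  forall (A : set (Rv R n)) (B : set (Rv R m)), measurable A -> measurable B ->
    P (V @^-1` A `&` Z @^-1` B) = (\int[P]_(w in Z @^-1` B) K (Z w) A)%E.

(** Convexity of an extended-real valued function (values in R U {+oo}). *)
Definition econvex {R : realType} {n : nat} (f : 'rV[R]_n -> \bar R) : Prop :=
  forall (x y : 'rV[R]_n) (t : R), 0 < t < 1 ->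
    (f ((1 - t) *: x + t *: y)%R <= (1 - t)%:E * f x + t%:E * f y)%E.

Definition egrad {R : realType} {n : nat} (f : 'rV[R]_n -> \bar R)
    (x g : 'rV[R]_n) : Prop :=
  [/\ \forall y \near x, f y \is a fin_num,
      differentiable (fun y => fine (f y)) x &
      forall h, 'd (fun y => fine (f y)) x h = dotv g h].

Definition cond_vquantile {R : realType} {d k : nat}
    (FU : set (Rv R d) -> \bar R) (K : 'rV[R]_k -> set (Rv R d) -> \bar R)
    (Zs : set 'rV[R]_k) (Q : 'rV[R]_d * 'rV[R]_k -> 'rV[R]_d) : Prop :=
  forall z, Zs z ->
    exists f : 'rV[R]_d -> \bar R,
      [/\ (forall u, (-oo < f u)%E), econvex f,
          {ae FU, forall u, egrad f u (Q (u, z))} &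
          forall A : set (Rv R d), measurable A ->
            FU ((fun u => Q (u, z)) @^-1` A) = K z A].

(** The underlying probability space
    (Om0 x Om1 x (0,1), P0 x P1 x Leb); the unit interval is represented as R
    with Lebesgue measure restricted to ]0,1[. *)
Definition Leb01 {R : realType} : set R -> \bar R :=
  fun A => lebesgue_measure (A `&` `]0, 1[).

Definition prodP {R : realType} {d0 d1} {T0 : measurableType d0}
    {T1 : measurableType d1} (P0 : set T0 -> \bar R) (P1 : set T1 -> \bar R)
  : set ((T0 * T1) * R) -> \bar R :=
  ((P0 \x P1) \x (@Leb01 R))%E.

Definition primal_feasible {R : realType} {dO} {Om : measurableType dO} {d k : nat}
    (P : set Om -> \bar R) (Z : Om -> Rv R k) (FU : set (Rv R d) -> \bar R)
    (V : Om -> Rv R d) : Prop :=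
  measurable_fun setT V /\ cond_law P V Z (fun _ => FU).

Definition primal_obj {R : realType} {dO} {Om : measurableType dO} {d : nat}
    (P : set Om -> \bar R) (Y V : Om -> Rv R d) : \bar R :=
  (\int[P]_w (dotv (V w) (Y w))%:E)%E.

Definition dual_feasible {R : realType} {d k : nat} (Zs : set 'rV[R]_k)
    (phi psi : 'rV[R]_d * 'rV[R]_k -> \bar R) : Prop :=
  [/\ measurable_fun setT (phi : Rv R d * Rv R k -> \bar R),
      measurable_fun setT (psi : Rv R d * Rv R k -> \bar R),
      (forall p, (-oo < phi p)%E /\ (-oo < psi p)%E),
      (forall z, Zs z -> lower_semicontinuous (fun u => phi (u, z)) /\
                         lower_semicontinuous (fun y => psi (y, z))) &
      forall z u y, Zs z -> ((dotv u y)%:E <= phi (u, z) + psi (y, z))%E].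

Definition dual_obj {R : realType} {dO} {Om : measurableType dO} {d k : nat}
    (P : set Om -> \bar R) (Y : Om -> Rv R d) (Z : Om -> Rv R k)
    (phi psi : 'rV[R]_d * 'rV[R]_k -> \bar R) (V : Om -> Rv R d) : \bar R :=
  (\int[P]_w (phi (V w, Z w) + psi (Y w, Z w)))%E.

(* Main.v *)
(** Fix [z] in the support of [Z].  The convex functions whose gradient is [Q (., z)] are
    given separately for each [z], so a potential that is Borel in [(u, z)] is rebuilt from
    [Q] alone, as a supremum over Rockafellar chains: the links are the balls with rational
    data charged by [FU], and the affine function attached to a ball is a weighted average
    of [x |-> <Q (v, z), x - v>] over it.  Shrinking the ball around a point where the
    given convex function is differentiable shows that [Q (u, z)] is a subgradient of the
    resulting [phi (., z)] at [FU]-almost every [u]; [psi (., z)] is the Legendre transform,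
    and Fenchel's equality holds along the coupling [y = Q (u, z)].

    A convex function fails to be differentiable at a point with a subgradient only if some
    coordinate direction has distinct one-sided slopes there.  The set of such points with a
    given rational slope in between meets each line in that direction at most once, hence is
    null by Tonelli; with densities on both sides this gives the gradients of [phi] and
    [psi].

    For the duality, [phi (V, Z)] and [psi (Y, Z)] need not be separately integrable; a
    truncation argument shows that the dual objective nevertheless does not depend on the
    feasible [V].  Weak duality is then Young's inequality, and Fenchel's equality along
    [U = Qinv (Y, Z)] gives both strong duality and uniqueness. *)

Require Import Defs.
From HB Require Import structures.
From mathcomp Require Import all_boot all_order all_algebra.
From mathcomp Require Import all_classical all_reals all_analysis.
From mathcomp Require Import measurable_realfun.
From mathcomp Require Import ring lra.
Import Order.TTheory GRing.Theory Num.Theory.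
Import numFieldNormedType.Exports.
Local Open Scope classical_set_scope.
Local Open Scope ring_scope.

(** * Borel sets of Euclidean space *)

(** The gradient property of [Q (., z)] fails on an [FU]-null set that varies with [z], so a chain
    through points would require good points chosen measurably in [z]. Averages over balls ignore
    null sets and are Borel in [z] by Fubini, and one base ball serves every [z]. The convex
    function given for a fixed [z] is used only at that [z]. Up to a constant it dominates the
    potential, which is therefore finite almost everywhere and bounded above on some ball. That
    bound allows the Legendre transform to be taken over rational points only, whence a Borel [psi].
    The exceptional sets must be Borel jointly in both variables, because they are carried from [FU]
    to [FYZ z] along [Q] and then integrated over the law of [Z]. This is why differentiability is
    replaced by countably many inequalities. *)

Section euclidean_borel.
Context {R : realType} {n : nat}.
Implicit Types (x y : 'rV[R]_n) (c : 'rV[rat]_n).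

Lemma coord_le_norm x i : `|x 0 i| <= `|x|.
Proof.
rewrite [leRHS]/Num.norm/= mx_normrE.
by apply/bigmax_geP; right; exists (0, i).
Qed.

Lemma norm_le_coord x (e : R) : 0 <= e -> (forall i, `|x 0 i| <= e) -> `|x| <= e.
Proof.
move=> e0 xe; rewrite /Num.norm/= mx_normrE; apply/bigmax_leP; split => //.
by move=> [i j] _ /=; rewrite (ord1 i).
Qed.

Lemma dotvC x y : dotv x y = dotv y x.
Proof. by apply: eq_bigr => i _; rewrite mulrC. Qed.

Lemma dotvDr x y z : dotv x (y + z) = dotv x y + dotv x z.
Proof. by rewrite /dotv -big_split/=; apply: eq_bigr => i _; rewrite mxE mulrDr. Qed.

Lemma dotvZr x y (t : R) : dotv x (t *: y) = t * dotv x y.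
Proof. by rewrite /dotv mulr_sumr; apply: eq_bigr => i _; rewrite mxE mulrCA. Qed.

Lemma dotvNr x y : dotv x (- y) = - dotv x y.
Proof. by rewrite -scaleN1r dotvZr mulN1r. Qed.

Lemma dotvBr x y z : dotv x (y - z) = dotv x y - dotv x z.
Proof. by rewrite dotvDr dotvNr. Qed.

Lemma dotvDl x y z : dotv (x + y) z = dotv x z + dotv y z.
Proof. by rewrite dotvC dotvDr !(dotvC z). Qed.

Lemma dotvZl x y (t : R) : dotv (t *: x) y = t * dotv x y.
Proof. by rewrite dotvC dotvZr dotvC. Qed.

Lemma dotvBl x y z : dotv (x - y) z = dotv x z - dotv y z.
Proof. by rewrite dotvC dotvBr !(dotvC z). Qed.

Lemma dotv_delta x i : dotv x (delta_mx 0 i) = x 0 i.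
Proof.
rewrite /dotv (bigD1 i)//= mxE !eqxx mulr1 big1 ?addr0// => j ji.
by rewrite mxE eqxx (negbTE ji) mulr0.
Qed.

Lemma dotv_norm_le x y : `|dotv x y| <= n%:R * (`|x| * `|y|).
Proof.
rewrite (le_trans (ler_norm_sum _ _ _))//.
rewrite mulr_natl (_ : _ *+ n = \sum_(i < n) `|x| * `|y|); last first.
  by rewrite sumr_const card_ord.
by apply: ler_sum => i _; rewrite normrM ler_pM// coord_le_norm.
Qed.

Lemma dotv_sqnorm_le x y : `|dotv x y| <= sqnorm x + sqnorm y.
Proof.
rewrite (le_trans (ler_norm_sum _ _ _))// /sqnorm -big_split/=.
apply: ler_sum => i _; rewrite ler_norml.
have := sqr_ge0 (x 0 i - y 0 i); have := sqr_ge0 (x 0 i + y 0 i).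
have := sqr_ge0 (x 0 i); have := sqr_ge0 (y 0 i).
by rewrite !expr2 => *; apply/andP; split; nra.
Qed.

(** The norm on row vectors is the maximum norm, so these cubes are balls, and they form a countable
    base of the topology. *)
Definition ratball (j : 'rV[rat]_n * nat) : set 'rV[R]_n :=
  [set x | forall i, `|x 0 i - ratr (j.1 0 i)| < j.2.+1%:R^-1].

Lemma rat_approx x (e : R) : 0 < e -> exists c, forall i, `|x 0 i - ratr (c 0 i)| < e.
Proof.
move=> e0.
have /choice[f fP] : forall i, exists q : rat, `|x 0 i - ratr q| < e.
  move=> i; have [q /andP[q1 q2]] : exists q : rat, x 0 i - e < ratr q < x 0 i.
    have [|q /itvP qi] := @rat_in_itvoo R (x 0 i - e) (x 0 i).
      by rewrite ltrBlDr ltrDl.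
    by exists q; rewrite !qi.
  by exists q; rewrite ltr_norml; apply/andP; split; lra.
by exists (\row_i f i) => i; rewrite mxE.
Qed.

(** Keeping even the closed ball inside [O] leaves room for the half-open cell of the same index, as
    [measurable_boxesE] requires. *)
Lemma ratball_base_closed (O : set 'rV[R]_n) x : open O -> O x ->
  exists j, ratball j x /\
    [set y : 'rV[R]_n | forall i, `|y 0 i - ratr (j.1 0 i)| <= j.2.+1%:R^-1] `<=` O.
Proof.
rewrite openE => oO /oO /nbhs_normP[e /= e0 eO].
have [k ke] : exists k : nat, k.+1%:R^-1 < e / 2.
  have e20 : 0 < e / 2 by rewrite divr_gt0.
  by have [N _ /(_ N (leqnn _))] := near_infty_natSinv_lt (PosNum e20); exists N.
have k0 : 0 < k.+1%:R^-1 :> R by rewrite invr_gt0.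
have [c cP] := rat_approx x _ k0.
exists (c, k); split => //= y yj; apply: eO => /=.
apply: (@le_lt_trans _ _ (k.+1%:R^-1 + k.+1%:R^-1)); last first.
  by rewrite (splitr e) ltrD.
apply: norm_le_coord; first by rewrite addr_ge0// ltW.
move=> i; rewrite !mxE.
rewrite -(subrKA (ratr (c 0 i))) (le_trans (ler_normD _ _))// lerD//; first exact: ltW.
by rewrite distrC; exact: yj.
Qed.

Lemma ratball_base (O : set 'rV[R]_n) x : open O -> O x ->
  exists j, ratball j x /\ ratball j `<=` O.
Proof.
move=> oO /(ratball_base_closed _ _ oO)[j [jx jO]]; exists j; split => //.
by move=> y jy; apply: jO => i; exact/ltW/jy.
Qed.

Lemma open_ratball j : open (ratball j).
Proof.
rewrite openE => x xj; apply/(@nbhs_normP R 'rV[R]_n).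
have [e e0 eP] : exists2 e : R, 0 < e & forall i, `|x 0 i - ratr (j.1 0 i)| + e < j.2.+1%:R^-1.
  pose g i := j.2.+1%:R^-1 - `|x 0 i - ratr (j.1 0 i)|.
  pose m := \big[Num.min/1]_(i < n) g i.
  have m0 : 0 < m by apply: lt_bigmin => // i _; rewrite subr_gt0 xj.
  exists (m / 2); first by rewrite divr_gt0.
  move=> i; have mg : m <= g i by exact: bigmin_le.
  rewrite -ltrBrDl (lt_le_trans _ mg)//.
  by rewrite ltr_pdivrMr// ltr_pMr// ltr1n.
exists e => //= y /= xy i.
rewrite -(subrKA (x 0 i)) (le_lt_trans (ler_normD _ _))//.
rewrite addrC (le_lt_trans _ (eP i))// lerD2l.
have := coord_le_norm (x - y) i; rewrite !mxE distrC => /le_trans; apply.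
exact: ltW.
Qed.

Lemma open_bigcup_ratball (O : set 'rV[R]_n) : open O ->
  O = \bigcup_(j in [set j | ratball j `<=` O]) ratball j.
Proof.
move=> oO; apply/seteqP; split => x.
  by move=> /(ratball_base _ _ oO)[j [jx jO]]; exists j.
by move=> [j /= jO /jO].
Qed.

Lemma open_measurable_rV (O : set (Rv R n)) : open (O : set 'rV[R]_n) -> measurable O.
Proof. by move=> oO; exact: sub_sigma_algebra. Qed.

Lemma measurable_ratball j : measurable (ratball j : set (Rv R n)).
Proof. by apply: open_measurable_rV; exact: open_ratball. Qed.

Lemma countable_bigcup_measurable d (T : measurableType d) (I : countType)
    (D : set I) (F : I -> set T) :
  (forall i, D i -> measurable (F i)) -> measurable (\bigcup_(i in D) F i).
Proof.
move=> mF; rewrite bigcup_mkcond; apply: countable_bigcupT_measurable => // i.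
by case: ifPn => //; rewrite inE => /mF.
Qed.

Lemma countable_bigcap_measurable d (T : measurableType d) (I : countType)
    (D : set I) (F : I -> set T) :
  (forall i, D i -> measurable (F i)) -> measurable (\bigcap_(i in D) F i).
Proof.
move=> mF; rewrite -[X in measurable X]setCK setC_bigcap; apply: measurableC.
by apply: countable_bigcup_measurable => i Di; exact/measurableC/mF.
Qed.

(** An open set is a countable union of rational cubes, and the preimage of a cube is a finite
    intersection of coordinate preimages of intervals. *)
Lemma measurable_rVP d (T : measurableType d) (f : T -> Rv R n) :
  (forall i, measurable_fun setT (fun t => (f t : 'rV[R]_n) 0 i)) ->
  measurable_fun setT f.
Proof.
move=> mf.
have mb j : measurable (f @^-1` ratball j).
  have -> : f @^-1` ratball j =
      \bigcap_(i in [set: 'I_n]) ((fun t => (f t : 'rV[R]_n) 0 i) @^-1` ball (ratr (j.1 0 i) : R) j.2.+1%:R^-1).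
    apply/seteqP; split => t /= tj i.
      by move=> _; rewrite /= /ball/= distrC; exact: tj.
    by have := tj i I; rewrite /= /ball/= distrC.
  apply: countable_bigcap_measurable => i _; rewrite -[X in measurable X]setTI.
  by apply: mf => //; exact: measurable_ball.
apply: (measurability (@open_rV R n : set (set (Rv R n)))) => //.
move=> _ [B oB <-]; rewrite setTI.
rewrite (open_bigcup_ratball B oB) preimage_bigcup.
exact: (@countable_bigcup_measurable _ _ ('rV[rat]_n * nat)%type).
Qed.

Lemma measurable_coord i : measurable_fun setT (fun x : Rv R n => (x : 'rV[R]_n) 0 i).
Proof.
apply: (measurability _ (RGenOpens.measurableE R)).
move=> _ [B [a [b ->]] <-]; rewrite setTI; apply: open_measurable_rV.
have : continuous (fun x : 'rV[R]_n => x 0 i) by exact: coord_continuous.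
by move=> /continuousP; apply; exact: interval_open.
Qed.

End euclidean_borel.

Section measurable_vectors.
Context {R : realType} {d : measure_display} {T : measurableType d}.

Lemma measurable_coord_comp {n} (f : T -> Rv R n) i : measurable_fun setT f ->
  measurable_fun setT (fun t => (f t : 'rV[R]_n) 0 i).
Proof. by move=> mf; exact: (measurableT_comp (measurable_coord i) mf). Qed.

Lemma measurable_dotv {n} (f g : T -> Rv R n) :
  measurable_fun setT f -> measurable_fun setT g ->
  measurable_fun setT (fun t => dotv (f t : 'rV[R]_n) (g t)).
Proof.
move=> mf mg; apply: measurable_sum => i.
by apply: measurable_funM; exact: measurable_coord_comp.
Qed.

Lemma measurable_addv {n} (f g : T -> Rv R n) :
  measurable_fun setT f -> measurable_fun setT g ->
  measurable_fun setT (fun t => ((f t : 'rV[R]_n) + (g t : 'rV[R]_n)) : Rv R n).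
Proof.
move=> mf mg; apply: measurable_rVP => i; under eq_fun do rewrite mxE.
by apply: measurable_funD; exact: measurable_coord_comp.
Qed.

Lemma measurable_scalev {n} (f : T -> R) (g : T -> Rv R n) :
  measurable_fun setT f -> measurable_fun setT g ->
  measurable_fun setT (fun t => (f t *: (g t : 'rV[R]_n)) : Rv R n).
Proof.
move=> mf mg; apply: measurable_rVP => i; under eq_fun do rewrite mxE.
by apply: measurable_funM => //; exact: measurable_coord_comp.
Qed.

Lemma measurable_sqnorm {n} (f : T -> Rv R n) : measurable_fun setT f ->
  measurable_fun setT (fun t => sqnorm (f t : 'rV[R]_n)).
Proof.
move=> mf; apply: measurable_sum => i.
by apply: measurable_funX; exact: measurable_coord_comp.
Qed.

Lemma measurable_countable_esup (I : countType) (F : I -> T -> \bar R) :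
  (forall i, measurable_fun setT (F i)) ->
  measurable_fun setT (fun t => ereal_sup [set F i t | i in [set: I]]).
Proof.
move=> mF; apply: (measurability _ (ErealGenOInfty.measurableE R)).
move=> _ [_ [r ->] <-]; rewrite setTI.
rewrite (_ : _ @^-1` _ = \bigcup_(i in [set: I]) (F i @^-1` `]r%:E, +oo[)).
  apply: countable_bigcup_measurable => i _; rewrite -[X in measurable X]setTI.
  by apply: mF => //; exact: emeasurable_itv.
apply/seteqP; split => t /=.
  rewrite in_itv/= andbT => /ereal_sup_gt[_ [i _ <-]] ri.
  by exists i => //=; rewrite in_itv/= andbT.
move=> [i _]/=; rewrite !in_itv/= !andbT => /lt_le_trans; apply.
by apply: ereal_sup_ubound; exists i.
Qed.

Lemma measurable_ltE (f g : T -> \bar R) :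
  measurable_fun setT f -> measurable_fun setT g ->
  measurable [set t | (f t < g t)%E].
Proof.
by move=> mf mg; rewrite -[X in measurable X]setTI; exact: measurable_lte.
Qed.

(** Strict inequalities are used because a difference of extended reals does not detect equality at
    infinite values. *)
Lemma measurable_eqE (f g : T -> \bar R) :
  measurable_fun setT f -> measurable_fun setT g ->
  measurable [set t | f t = g t].
Proof.
move=> mf mg.
rewrite (_ : mkset _ = ~` ([set t | (f t < g t)%E] `|` [set t | (g t < f t)%E])).
  by apply/measurableC/measurableU; exact: measurable_ltE.
apply/seteqP; split => t /=; first by move=> ->; rewrite ltxx => -[].
by move=> /not_orP[/negP + /negP]; rewrite -!leNgt => *; apply/eqP; rewrite eq_le; exact/andP.
Qed.

End measurable_vectors.

(** * Supports of Borel measures *)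

Section support.
Context {R : realType} {n : nat}.

Lemma closed_supp (mu : set (Rv R n) -> \bar R) : closed (supp mu).
Proof.
rewrite -[supp mu]setCK; apply: open_closedC; rewrite openE => x /= /existsNP[B].
move=> /not_implyP[oB /not_implyP[Bx muB]].
rewrite /interior nbhsE; exists B => // y By /(_ B oB By).
exact: muB.
Qed.

Lemma measurable_supp (mu : set (Rv R n) -> \bar R) : measurable (supp mu : set (Rv R n)).
Proof.
rewrite -[supp mu]setCK; apply: measurableC; apply: open_measurable_rV.
exact/closed_openC/closed_supp.
Qed.

Lemma negligible_countable_bigcup d (T : measurableType d) (I : countType)
    (mu : {measure set T -> \bar R}) (F : I -> set T) :
  (forall i, mu.-negligible (F i)) -> mu.-negligible (\bigcup_(i in [set: I]) F i).
Proof.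
move=> nF.
have : mu.-negligible (\bigcup_k (if unpickle k is Some i then F i else set0)).
  apply: negligible_bigcup => k; case: unpickle => [i|]; first exact: nF.
  exact: negligible_set0.
by apply: negligibleS => x [i _ Fix]; exists (pickle i) => //; rewrite pickleK.
Qed.

Lemma negligible_null_ratballs (mu : {measure set (Rv R n) -> \bar R}) :
  mu.-negligible [set x : Rv R n | exists2 j, mu (ratball j) = 0%E & ratball j x].
Proof.
have := @negligible_countable_bigcup _ _ ('rV[rat]_n * nat)%type mu
  (fun j => if mu (ratball j) == 0%E then ratball j else set0).
rewrite (_ : bigcup _ _ = [set x : Rv R n | exists2 j, mu (ratball j) = 0%E & ratball j x]).
  apply => j; case: ifPn => [/eqP mu0|_]; last exact: negligible_set0.
  by apply/negligibleP => //; exact: measurable_ratball.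
apply/seteqP; split => x /=.
  by move=> [j _]; case: ifPn => // /eqP ? ?; exists j.
by move=> [j mu0 jx]; exists j => //; rewrite mu0 eqxx.
Qed.

Lemma ae_ratball_neq0 (mu : {measure set (Rv R n) -> \bar R}) :
  {ae mu, forall x : Rv R n, forall j, ratball j x -> mu (ratball j) != 0%E}.
Proof.
apply: negligibleS (negligible_null_ratballs mu) => x /= /existsNP[j].
by move=> /not_implyP[jx /negP/negPn/eqP mu0]; exists j.
Qed.

(** A point outside the support has a null open neighbourhood, hence lies in one of the countably
    many null rational cubes. *)
Lemma negligible_suppC (mu : {measure set (Rv R n) -> \bar R}) :
  mu.-negligible (~` supp mu).
Proof.
apply: negligibleS (negligible_null_ratballs mu) => x /= /existsNP[B].
move=> /not_implyP[oB /not_implyP[Bx muB]].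
have [j [jx jB]] := ratball_base _ _ oB Bx; exists j => //.
have mj : measurable (ratball j : set (Rv R n)).
  exact: measurable_ratball.
apply/eqP; rewrite eq_le measure_ge0 andbT.
move/negP : muB; rewrite -leNgt; apply: le_trans.
by apply: le_measure => //; rewrite inE//; exact: open_measurable_rV.
Qed.

End support.

Section almost_everywhere_measure.
Context {d} {T : measurableType d} {R : realType}.
Implicit Types A B : T -> Prop.

Lemma aeS (mu : {measure set T -> \bar R}) A B : (forall x, A x -> B x) ->
  {ae mu, forall x, A x} -> {ae mu, forall x, B x}.
Proof. by move=> AB; apply: negligibleS => x /= nB Ax; exact/nB/AB. Qed.

Lemma aeI (mu : {measure set T -> \bar R}) A B : {ae mu, forall x, A x} ->
  {ae mu, forall x, B x} -> {ae mu, forall x, A x /\ B x}.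
Proof.
by move=> muA muB; apply: negligibleS (negligibleU muA muB) => x /= /not_andP.
Qed.

Lemma ae_ex (P : probability T R) A : {ae P, forall x, A x} -> exists x, A x.
Proof.
move=> PA; apply: contrapT => /forallNP nA.
have : P setT = 0%E.
  by apply: measure_negligible => //; apply: negligibleS PA => x _; exact: nA.
by move/eqP; rewrite probability_setT onee_eq0.
Qed.

End almost_everywhere_measure.

(** * Lebesgue-null sets and lines *)

Section pushforward_as_measure.
Context d d' (T1 : measurableType d) (T2 : measurableType d') (R : realType).
Variables (m : {measure set T1 -> \bar R}) (f : T1 -> T2).
Hypothesis mf : measurable_fun setT f.

Definition pushm : {measure set T2 -> \bar R} :=
  measure_function_pushforward__canonical__measure_function_Measure m mf.

Lemma pushmE A : pushm A = m (f @^-1` A). Proof. by []. Qed.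

End pushforward_as_measure.
Arguments pushm {d d' T1 T2 R} m {f} mf.

Section lebesgue_translation.
Context {R : realType} {n : nat} (lam : {measure set (Rv R n) -> \bar R}).
Hypothesis lamE : is_lebesgue_Rn lam.

Definition box (a b : 'rV[R]_n) : set (Rv R n) :=
  [set x : 'rV[R]_n | forall i, a 0 i <= x 0 i < b 0 i].

Definition boxes : set (set (Rv R n)) := [set A | exists a b, A = box a b].

Lemma measurable_box a b : measurable (box a b).
Proof.
rewrite (_ : box a b = \bigcap_(i in [set: 'I_n])
    ((fun x : Rv R n => (x : 'rV[R]_n) 0 i) @^-1` `[a 0 i, b 0 i[)).
  apply: countable_bigcap_measurable => i _; rewrite -[X in measurable X]setTI.
  by apply: measurable_coord => //; exact: measurable_itv.
apply/seteqP; split => x /= xab i; first by move=> _; rewrite /= in_itv/= xab.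
by have := xab i I; rewrite /= in_itv.
Qed.

Lemma measurable_boxesE : @measurable _ (Rv R n) = <<s boxes >>.
Proof.
apply/seteqP; split; last first.
  apply: smallest_sub; first exact: sigma_algebra_measurable.
  by move=> _ [a [b ->]]; exact: measurable_box.
apply: smallest_sub => [|B oB]; first exact: smallest_sigma_algebra.
pose cell (j : 'rV[rat]_n * nat) := box
  (\row_i (ratr (j.1 0 i) - j.2.+1%:R^-1)) (\row_i (ratr (j.1 0 i) + j.2.+1%:R^-1)).
(* A half-open cell lies between the open and the closed rational ball of the same index. *)
have -> : B = \bigcup_(j in [set j | cell j `<=` B]) cell j.
  apply/seteqP; split => [x Bx|x [j /= jB /jB//]].
  have [j [jx jB]] := ratball_base_closed _ _ oB Bx.
  exists j => [y jy|i].
    apply: jB => i; rewrite ler_distl.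
    by have /andP[] := jy i; rewrite !mxE => -> /ltW ->.
  by have := jx i; rewrite ltr_distl !mxE => /andP[/ltW -> ->].
have mcell j : <<s boxes >> (cell j) by apply: sub_sigma_algebra; do 2 eexists.
rewrite bigcup_mkcond.
apply: (@countable_bigcupT_measurable _ (g_sigma_algebraType boxes)
  ('rV[rat]_n * nat)%type) => // j; case: ifPn => // _.
exact: mcell.
Qed.

Lemma setI_closed_boxes : setI_closed boxes.
Proof.
move=> _ _ [a [b ->]] [a' [b' ->]].
exists (\row_i Num.max (a 0 i) (a' 0 i)), (\row_i Num.min (b 0 i) (b' 0 i)).
apply/seteqP; split => x.
  move=> [xab xab'] i; rewrite !mxE ge_max lt_min.
  by have /andP[-> ->] := xab i; have /andP[-> ->] := xab' i.
move=> xab; split => i; have := xab i; rewrite !mxE ge_max lt_min.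
  by move=> /andP[/andP[-> _] /andP[-> _]].
by move=> /andP[/andP[_ ->] /andP[_ ->]].
Qed.

Definition cube (k : nat) : set (Rv R n) := box (const_mx (- k%:R)) (const_mx k%:R).

Lemma bigcup_cube : \bigcup_k cube k = setT.
Proof.
rewrite -subTset => x _; exists (Num.truncn `|x : 'rV[R]_n|).+1 => // i; rewrite !mxE.
have := coord_le_norm x i => xi.
have := truncnS_gt `|x : 'rV[R]_n|; move: (Num.truncn _).+1 => k /(le_lt_trans xi).
by rewrite ltr_norml => /andP[/ltW -> ->].
Qed.

Lemma cube_lty k : (lam (cube k) < +oo)%E.
Proof.
rewrite [lam _]lamE; first by rewrite ltry.
by move=> i; rewrite !mxE (@le_trans _ _ 0)// oppr_le0.
Qed.

Lemma measurable_translation (v : 'rV[R]_n) :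
  measurable_fun setT (fun x : Rv R n => ((x : 'rV[R]_n) + v) : Rv R n).
Proof. by apply: measurable_addv; [exact: measurable_id|exact: measurable_cst]. Qed.

(** Only the volumes of boxes are known, so invariance comes from uniqueness of measures on the
    intersection-stable class of boxes, with [cube] as the exhausting sequence. *)
Lemma lebesgue_translation_invariant (v : 'rV[R]_n) (A : set (Rv R n)) :
  measurable A -> lam ((fun x : Rv R n => ((x : 'rV[R]_n) + v) : Rv R n) @^-1` A) = lam A.
Proof.
move=> mA; rewrite -(pushmE _ _ _ _ _ lam _ (measurable_translation v)).
apply/esym; apply: (measure_unique boxes cube) => //.
- exact: measurable_boxesE.
- exact: setI_closed_boxes.
- by move=> k; exists (const_mx (- k%:R)), (const_mx k%:R).
- exact: bigcup_cube.
- move=> _ [a [b ->]]; rewrite pushmE.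
  rewrite (_ : _ @^-1` _ = box (a - v) (b - v)); last first.
    by apply/seteqP; split => x xab i; have := xab i; rewrite !mxE lerBlDr ltrBrDr.
  have [ab|/existsNP[i /negP]] := pselect (forall i, a 0 i <= b 0 i).
    rewrite [LHS]lamE// [RHS]lamE; last by move=> i; rewrite !mxE lerD2r.
    by congr EFin; apply: eq_bigr => i _; rewrite !mxE; ring.
  (* [is_lebesgue_Rn] is silent when some side is reversed; then both boxes are empty. *)
  rewrite -ltNge => ba.
  rewrite (_ : box a b = set0); last first.
    by rewrite -subset0 => x /(_ i) /andP[/le_lt_trans h /h /(lt_trans ba)]; rewrite ltxx.
  rewrite (_ : box _ _ = set0)//.
  rewrite -subset0 => x /(_ i); rewrite !mxE lerBlDr ltrBrDr => /andP[/le_lt_trans h /h /(lt_trans ba)].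
  by rewrite ltxx.
- exact: cube_lty.
Qed.

Lemma lebesgue_sigma_finite : sigma_finite setT lam.
Proof.
exists cube; first by rewrite bigcup_cube.
by move=> k; split; [exact: measurable_box|exact: cube_lty].
Qed.

Let mu : set (Rv R n) -> \bar R := lam.
HB.instance Definition _ := Measure.on mu.
HB.instance Definition _ :=
  Measure_isSigmaFinite.Build _ _ _ mu lebesgue_sigma_finite.

(* Tonelli on [{(x, t) | N (x + t v)}]: the sections in [t] are null by hypothesis,
   those in [x] all have measure [lam N]. *)
Lemma null_of_null_lines (N : set (Rv R n)) (v : 'rV[R]_n) : measurable N ->
  (forall x : 'rV[R]_n, lebesgue_measure [set t : R | N (x + t *: v)] = 0%E) ->
  lam N = 0%E.
Proof.
move=> mN N0.
pose S := [set p : Rv R n * R | N ((p.1 : 'rV[R]_n) + p.2 *: v)].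
have mS : measurable S.
  rewrite -[S]setTI; apply: (measurable_addv) => //.
  by apply: measurable_scalev.
have := @indic_fubini_tonelli _ _ _ _ _ (mu : {sigma_finite_measure set _ -> \bar R}) (@lebesgue_measure R) S mS.
rewrite indic_fubini_tonelli_FE// indic_fubini_tonelli_GE//.
rewrite (_ : lebesgue_measure \o _ = cst 0%E); last first.
  apply/funext => x /=; rewrite -[RHS](N0 x); congr lebesgue_measure.
  by apply/seteqP; split => t /=; rewrite /xsection /= inE.
rewrite (_ : mu \o _ = cst (lam N)); last first.
  apply/funext => t /=; rewrite -[RHS](lebesgue_translation_invariant (t *: v))//.
  by congr (lam _); apply/seteqP; split => x /=; rewrite /ysection /= inE.
(* Tonelli now equates 0 with [lam N] times the length of the whole line; that length being
   infinite, [lam N] is 0. *)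
have leb_lt : lebesgue_measure [set: R] = +oo%E.
  by rewrite -set_itvNyy lebesgue_measure_itv.
rewrite integral_cst// integral_cst// mul0e => /esym/eqP.
by rewrite mule_eq0 => /orP[/eqP//|]; rewrite [X in X == _]leb_lt.
Qed.

End lebesgue_translation.

Lemma density_null {R : realType} {n} (lam : {measure set (Rv R n) -> \bar R})
    (mu : set (Rv R n) -> \bar R) (A : set (Rv R n)) :
  has_density lam mu -> measurable A -> lam A = 0%E -> mu A = 0%E.
Proof.
move=> [f [mf f0 muE]] mA A0; rewrite muE//.
by apply: null_set_integral => //; exact: measurable_funTS.
Qed.

(** * Subgradients and gradients *)

Lemma diff_of_expansion {K : numFieldType} {V W : normedModType K} (f : V -> W)
    (L : {linear V -> W}) (x : V) : continuous L ->
  (forall e : K, 0 < e -> \forall h \near (0 : V), `|f (h + x) - f x - L h| <= e * `|h|) ->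
  differentiable f x /\ 'd f x = L :> (V -> W).
Proof.
move=> cL fL.
have o : f \o shift x = cst (f x) + L +o_ (0 : V) id.
  apply/eqaddoP => _/posnumP[e]; near=> h => /=.
  rewrite -![(_ + _ : _ -> _) _]/(_ + _) -![(- _ : _ -> _) _]/(- _) /= /cst.
  rewrite -![(_ + _ : _ -> _) _]/(_ + _) /= opprD addrA.
  by near: h; exact: fL.
have dE := diff_unique cL o.
by split => //; apply/diff_locallyP; rewrite dE.
Unshelve. all: by end_near. Qed.

Section convex_gradient.
Context {R : realType} {n : nat}.
Implicit Types (f g : 'rV[R]_n -> \bar R) (x y p h : 'rV[R]_n).

Definition subgrad g x p := forall y, (g x + (dotv p (y - x))%:E <= g y)%E.

Lemma continuous_dotv p : continuous (dotv p).
Proof.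
move=> x; have FF : Filter (nbhs x) by exact: nbhs_filter.
apply/(@cvgrPdist_le R R _ (nbhs x) FF) => /= e e0.
have c0 : 0 < n%:R * `|p| + 1 by rewrite ltr_wpDl// mulr_ge0.
apply/(@nbhs_normP R 'rV[R]_n); exists (e / (n%:R * `|p| + 1)) => /=; first by rewrite divr_gt0.
move=> y /= /ltW; rewrite ler_pdivlMr// => xy.
rewrite -dotvBr (le_trans (dotv_norm_le _ _))//.
rewrite mulrA (le_trans _ xy)// mulrC ler_wpM2l// lerDl.
exact: ler01.
Qed.

(** Every later argument on gradients uses this epsilon form, in which finiteness near [x] and the
    first-order expansion share one radius. *)
Lemma egradP g x p : egrad g x p <->
  (forall e : R, 0 < e -> exists2 dl : R, 0 < dl & forall h, `|h| < dl ->
    g (x + h) \is a fin_num /\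
    `|fine (g (x + h)) - fine (g x) - dotv p h| <= e * `|h|).
Proof.
have dl : linear (dotv p : 'rV[R]_n -> R).
  by move=> a u v; rewrite dotvDr dotvZr.
pose L : {linear 'rV[R]_n -> R} := HB.pack (dotv p : 'rV[R]_n -> R)
  (GRing.isLinear.Build _ _ _ _ _ dl).
split.
  move=> [/nbhs_normP[r /= r0 rfin] df gE] e e0.
  have := diff_locally df => /eqaddoP /(_ _ e0) /nbhs_normP[s /= s0 sP].
  exists (Num.min r s); first by rewrite lt_min r0 s0.
  move=> h; rewrite lt_min => /andP[hr hs]; split.
    by apply: rfin => /=; rewrite opprD addrA subrr sub0r normrN.
  have := sP h; rewrite /= sub0r normrN => /(_ hs).
  rewrite -![(_ + _ : _ -> _) _]/(_ + _) -![(- _ : _ -> _) _]/(- _) /= /cst.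
  by rewrite -![(_ + _ : _ -> _) _]/(_ + _) gE opprD addrA (addrC h).
move=> gx.
have [r r0 rfin] := gx 1 ltr01.
have cL : continuous L by exact: continuous_dotv.
have [|df dE] := @diff_of_expansion _ _ _ (fun y => fine (g y)) L x cL.
  move=> e e0; have [s s0 sP] := gx e e0.
  apply/(@nbhs_normP R 'rV[R]_n); exists s => //= h /=; rewrite sub0r normrN => /sP[_].
  by rewrite (addrC h).
split.
- apply/(@nbhs_normP R 'rV[R]_n); exists r => //= y /= xy.
  have [|+ _] := rfin (y - x); first by rewrite distrC.
  by rewrite addrC subrK.
- exact: df.
- by move=> h; rewrite dE.
Qed.

Lemma egrad_fin_num g x p : egrad g x p -> g x \is a fin_num.
Proof.
move=> /egradP /(_ 1 ltr01)[r r0 /(_ 0)]; rewrite normr0 => /(_ r0)[].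
by rewrite addr0.
Qed.

(** Convexity bounds [g] from above at a point close to [x] on the segment to [y], the expansion
    bounds it from below there; dividing by the parameter [t] gives the inequality up to [e]. *)
Lemma egrad_subgrad g x p : (forall y, (-oo < g y)%E) -> econvex g ->
  egrad g x p -> subgrad g x p.
Proof.
move=> gNy gc gp y; have gx := egrad_fin_num _ _ _ gp.
have [->|gy] := eqVneq (g y) +oo%E; first by rewrite leey.
have {gy} gyf : g y \is a fin_num by rewrite fin_numE gt_eqF//= gy.
rewrite -(fineK gx) -(fineK gyf) -EFinD lee_fin.
set h := y - x; apply/ler_addgt0Pl => e e0.
have e10 : 0 < e / (`|h| + 1) by rewrite divr_gt0// ltr_wpDl.
move/egradP : gp => /(_ _ e10)[r r0 rP].
(* The first bound keeps [t] below 1 for convexity, the second keeps [t *: h] inside the radius [r];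
   adding 1 covers [h = 0]. *)
pose t := Num.min (1 / 2) (r / (`|h| + 1) / 2).
have h1 : 0 < `|h| + 1 by rewrite ltr_wpDl.
have t0 : 0 < t by rewrite lt_min !divr_gt0.
have t1 : t < 1 by rewrite gt_min; apply/orP; left; lra.
have th : `|t *: h| < r.
  rewrite normrZ gtr0_norm//.
  have tr : t <= r / (`|h| + 1) / 2 by rewrite ge_min lexx orbT.
  rewrite (le_lt_trans (ler_wpM2r _ tr))//.
  rewrite -!mulrA gtr_pMr// mulrC ltr_pdivrMr// mul1r.
  by have := normr_ge0 h; lra.
have [fth lth] := rP _ th.
have := gc x y t; rewrite t0 t1 => /(_ isT).
have -> : (1 - t) *: x + t *: y = x + t *: h.
  by rewrite /h scalerBl scale1r scalerBr addrA addrAC.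
rewrite -(fineK fth) -(fineK gx) -(fineK gyf) -!EFinM -EFinD lee_fin => cvx.
move: lth; rewrite ler_norml dotvZr normrZ (gtr0_norm t0) => /andP[lth _].
have eh : e / (`|h| + 1) * `|h| <= e.
  by rewrite mulrAC ler_pdivrMr// ler_pM2l// lerDl ler01.
have : t * (dotv p h + fine (g x)) <= t * (e + fine (g y)).
  have : t * (e / (`|h| + 1) * `|h|) <= t * e by rewrite ler_pM2l.
  by lra.
by rewrite ler_pM2l// addrC.
Qed.

(** Steps of both signs along a coordinate axis bound [q 0 i - p 0 i] by any [e] from either
    side. *)
Lemma egrad_subgrad_unique g x p q : egrad g x p -> subgrad g x q -> q = p.
Proof.
move=> gp gq; have gx := egrad_fin_num _ _ _ gp; apply/rowP => i.
suff H (e : R) : 0 < e -> `|q 0 i - p 0 i| <= e.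
  apply/eqP; rewrite -subr_eq0 -normr_le0; apply/ler_addgt0Pl => e e0.
  by rewrite addr0 H.
move=> e0; move/egradP : gp => /(_ _ e0)[r r0 rP].
have key (s : R) : `|s| < r -> s * (q 0 i - p 0 i) <= e * `|s|.
  move=> sr.
  have dE : `|s *: delta_mx 0 i : 'rV[R]_n| <= `|s|.
    rewrite normrZ ler_piMr//; apply: norm_le_coord => // j.
    by rewrite mxE eqxx/=; case: (j == i); rewrite ?normr1 ?normr0.
  have [fh] := rP _ (le_lt_trans dE sr); rewrite ler_norml => /andP[_ up].
  have := gq (x + s *: delta_mx 0 i).
  rewrite addrAC subrr add0r -(fineK fh) -(fineK gx) -EFinD lee_fin.
  move: up; rewrite !dotvZr !dotv_delta => up low.
  have : e * `|s *: delta_mx 0 i : 'rV[R]_n| <= e * `|s| by rewrite ler_pM2l.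
  by lra.
have r20 : 0 < r / 2 by rewrite divr_gt0.
have r2r : r / 2 < r by rewrite ltr_pdivrMr// ltr_pMr// ltr1n.
rewrite ler_norml; apply/andP; split.
  have := key (- (r / 2)); rewrite normrN gtr0_norm// => /(_ r2r).
  by rewrite mulNr -mulrN mulrC ler_pM2r// lerNl.
have := key (r / 2); rewrite gtr0_norm// => /(_ r2r).
by rewrite mulrC ler_pM2r.
Qed.

(** Jensen's inequality with equal weights, by splitting off one point against the average of the
    others. It serves to combine upper bounds along the coordinate axes. *)
Lemma econvex_average g m (y : 'I_m.+1 -> 'rV[R]_n) (r : 'I_m.+1 -> R) :
  (forall y, (-oo < g y)%E) -> econvex g -> (forall i, (g (y i) <= (r i)%:E)%E) ->
  (g (m.+1%:R^-1 *: \sum_i y i)%R <= (m.+1%:R^-1 * \sum_i r i)%:E)%E.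
Proof.
move=> gNy gc; elim: m y r => [|m ih] y r yr.
  by rewrite !big_ord_recl !big_ord0 !addr0 invr1 scale1r mul1r.
have {ih} := ih (fun i => y (lift ord0 i)) (fun i => r (lift ord0 i)) (fun i => yr _).
set Y := (m.+1%:R^-1 *: _); set S := (_ * _) => gY.
rewrite big_ord_recl [X in (_ * X)%:E]big_ord_recl /=.
pose t : R := m.+2%:R^-1.
have t0 : 0 < t by rewrite invr_gt0.
have t1 : t < 1 by rewrite invf_lt1// ltr1n.
have tE : 1 - t = t * m.+1%:R.
  have : m.+2%:R != 0 :> R by [].
  by rewrite /t -(natr1 m.+1) => ?; field.
have -> : m.+2%:R^-1 *: (y ord0 + \sum_(i < m.+1) y (lift ord0 i)) =
    (1 - t) *: Y + t *: y ord0.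
  rewrite tE /Y scalerA -mulrA divff// mulr1 scalerDr addrC//.
have -> : m.+2%:R^-1 * (r ord0 + \sum_(i < m.+1) r (lift ord0 i)) =
    (1 - t) * S + t * r ord0.
  by rewrite tE /S mulrA -(mulrA t) divff// mulr1 mulrDr addrC.
apply: (le_trans (gc Y (y ord0) t _)); first by rewrite t0 t1.
rewrite [leRHS]EFinD !EFinM; apply: leeD; apply: lee_wpmul2l => //.
  by rewrite lee_fin ltW// subr_gt0.
by rewrite lee_fin ltW.
Qed.

(* For convex [g] the difference quotients are monotone, so steps [1/k] suffice to say that
   [q] lies strictly between the one-sided slopes of [g] at [x] in direction [i]. *)
Definition kink g i (q : rat) : set 'rV[R]_n := [set x | (g x < +oo)%E /\
  forall k : nat,
    (g x + (ratr q * k.+1%:R^-1)%:E < g (x + k.+1%:R^-1 *: delta_mx 0 i)%R)%E /\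
    (g x - (ratr q * k.+1%:R^-1)%:E < g (x - k.+1%:R^-1 *: delta_mx 0 i)%R)%E].

(** The chord between two such points would have slope above [q], by the forward step at the first
    point, and below [q], by the backward step at the second. *)
Lemma kink_line_lt g i q x (t t' : R) : (forall y, (-oo < g y)%E) -> econvex g ->
  t < t' -> kink g i q (x + t *: delta_mx 0 i) ->
  kink g i q (x + t' *: delta_mx 0 i) -> False.
Proof.
move=> gNy gc tt'.
set a := x + t *: _; set b := x + t' *: _.
move=> [ay aq] [by_ bq].
have af : g a \is a fin_num by rewrite fin_numElt gNy ay.
have bf : g b \is a fin_num by rewrite fin_numElt gNy by_.
have l0 : 0 < t' - t by rewrite subr_gt0.
have [k kl] : exists k : nat, k.+1%:R^-1 < t' - t.
  by have [N _ /(_ N (leqnn _))] := near_infty_natSinv_lt (PosNum l0); exists N.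
move: (aq k) (bq k) => [+ _] [_]; clear aq bq.
set s := k.+1%:R^-1 in kl *; set l := t' - t in l0 kl *.
have s0 : 0 < s by rewrite invr_gt0.
pose u := s / l.
have u0 : 0 < u by rewrite divr_gt0.
have u1 : u < 1 by rewrite ltr_pdivrMr// mul1r.
have ul : u * l = s by rewrite divfK// gt_eqF.
have Ea : a + s *: delta_mx 0 i = (1 - u) *: a + u *: b.
  rewrite /a /b !scalerDr !scalerBl !scale1r -ul /l !scalerA.
  by apply/rowP => j; rewrite !mxE; ring.
have Eb : b - s *: delta_mx 0 i = (1 - u) *: b + u *: a.
  rewrite /a /b !scalerDr !scalerBl !scale1r -ul /l !scalerA.
  by apply/rowP => j; rewrite !mxE; ring.
rewrite Ea Eb => /lt_le_trans /(_ (gc a b u _)); rewrite u0 u1 => /(_ isT) h1.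
move=> /lt_le_trans /(_ (gc b a u _)); rewrite u0 u1 => /(_ isT).
move: h1; rewrite -(fineK af) -(fineK bf) -!EFinM -!EFinN -!EFinD !lte_fin.
by lra.
Qed.

Lemma kink_line_null g i q x : (forall y, (-oo < g y)%E) -> econvex g ->
  lebesgue_measure [set t : R | kink g i q (x + t *: delta_mx 0 i)] = 0%E.
Proof.
move=> gNy gc.
have [[t tK]|N0] := pselect (exists t : R, kink g i q (x + t *: delta_mx 0 i)).
  rewrite (_ : mkset _ = [set t]) ?lebesgue_measure_set1//.
  apply/seteqP; split => [t' /= t'K|_ ->//].
  have [] := ltgtP t t'.
  - by move=> /(kink_line_lt _ _ _ _ _ _ gNy gc) /(_ tK t'K).
  - by move=> /(kink_line_lt _ _ _ _ _ _ gNy gc) /(_ t'K tK).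
  - by [].
rewrite (_ : mkset _ = set0) ?measure0// -subset0 => t tK.
by apply: N0; exists t.
Qed.

(** The subgradient supplies the lower half of the expansion. The upper half holds along each axis
    because there is no kink, and Jensen's inequality extends it to all directions. *)
Lemma subgrad_kinkN_egrad g x p : (forall y, (-oo < g y)%E) -> econvex g ->
  (g x < +oo)%E -> subgrad g x p -> (forall i q, ~ kink g i q x) -> egrad g x p.
Proof.
move=> gNy gc gxy gp nk.
have gx : g x \is a fin_num by rewrite fin_numElt gNy gxy.
have gpi i s : ((fine (g x) + s * p 0 i)%:E <= g (x + s *: delta_mx 0 i)%R)%E.
  have := gp (x + s *: delta_mx 0 i).
  by rewrite addrAC subrr add0r dotvZr dotv_delta -{1}(fineK gx).
(* By convexity an affine upper bound at one step length holds at all shorter ones, so a single step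
   [1/k] yields a whole interval. *)
have scale (i : 'I_n) (a s b : R) : 0 <= a <= 1 ->
    (g (x + s *: delta_mx 0 i)%R <= (fine (g x) + s * b)%:E)%E ->
    (g (x + (a * s) *: delta_mx 0 i)%R <= (fine (g x) + a * s * b)%:E)%E.
  move=> /andP[]; rewrite le_eqVlt => /predU1P[<- _ _|a0].
    by rewrite !mul0r scale0r !addr0 fineK.
  rewrite le_eqVlt => /predU1P[->|a1 gs]; first by rewrite !mul1r.
  have -> : x + (a * s) *: delta_mx 0 i = (1 - a) *: x + a *: (x + s *: delta_mx 0 i).
    by apply/rowP => j; rewrite !mxE; ring.
  apply: (le_trans (gc _ _ _ _)); first by rewrite a0 a1.
  rewrite (_ : (fine (g x) + a * s * b) = (1 - a) * fine (g x) + a * (fine (g x) + s * b)); last by ring.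
  rewrite -[in leLHS](fineK gx) -EFinM EFinD leeD2l// EFinM lee_wpmul2l//.
  by rewrite lee_fin ltW.
(* Take a rational slope between [p 0 i] and [p 0 i + e]. Some step [1/k] violates the kink
   condition; the subgradient inequality secures the backward half, so the forward half fails, and
   that is the bound. *)
have right i (e : R) : 0 < e -> exists2 dl : R, 0 < dl & forall s, 0 <= s < dl ->
    (g (x + s *: delta_mx 0 i)%R <= (fine (g x) + s * (p 0 i + e))%:E)%E.
  move=> e0.
  have [q /itvP qe] := @rat_in_itvoo R (p 0 i) (p 0 i + e) (ltr_pwDr e0 (lexx _)).
  have /existsNP[k nkk] : ~ (forall k : nat,
    (g x + (ratr q * k.+1%:R^-1)%:E < g (x + k.+1%:R^-1 *: delta_mx 0 i)%R)%E /\
    (g x - (ratr q * k.+1%:R^-1)%:E < g (x - k.+1%:R^-1 *: delta_mx 0 i)%R)%E).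
    by move=> h; apply: (nk i q).
  exists k.+1%:R^-1; first by rewrite invr_gt0.
  have dl0 : 0 < k.+1%:R^-1 :> R by rewrite invr_gt0.
  set dl := k.+1%:R^-1 in nkk dl0 *.
  have up : (g (x + dl *: delta_mx 0 i)%R <= (fine (g x) + dl * (p 0 i + e))%:E)%E.
    rewrite leNgt; apply/negP => lt; apply: nkk; split.
      rewrite (le_lt_trans _ lt)// -{1}(fineK gx) -EFinD lee_fin lerD2l mulrC.
      by rewrite ler_pM2l// ltW// qe.
    rewrite -scaleNr (lt_le_trans _ (gpi i (- dl)))// -(fineK gx) -EFinN -EFinD.
    by rewrite lte_fin ltrD2l mulrC mulNr ltrN2 ltr_pM2l// qe.
  move=> s /andP[s0 sdl].
  have := scale i (s / dl) dl (p 0 i + e); rewrite divfK ?gt_eqF//; apply => //.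
  by rewrite divr_ge0//= ?ler_pdivrMr ?mul1r// ltW.
have left i (e : R) : 0 < e -> exists2 dl : R, 0 < dl & forall s, 0 <= s < dl ->
    (g (x + (- s) *: delta_mx 0 i)%R <= (fine (g x) + (- s) * (p 0 i - e))%:E)%E.
  move=> e0.
  have [q /itvP qe] : exists q : rat, ratr q \in `](p 0 i - e), (p 0 i)[.
    by apply: rat_in_itvoo; rewrite ltrBlDr ltrDl.
  have /existsNP[k nkk] : ~ (forall k : nat,
    (g x + (ratr q * k.+1%:R^-1)%:E < g (x + k.+1%:R^-1 *: delta_mx 0 i)%R)%E /\
    (g x - (ratr q * k.+1%:R^-1)%:E < g (x - k.+1%:R^-1 *: delta_mx 0 i)%R)%E).
    by move=> h; apply: (nk i q).
  exists k.+1%:R^-1; first by rewrite invr_gt0.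
  have dl0 : 0 < k.+1%:R^-1 :> R by rewrite invr_gt0.
  set dl := k.+1%:R^-1 in nkk dl0 *.
  have up : (g (x + (- dl) *: delta_mx 0 i)%R <= (fine (g x) + (- dl) * (p 0 i - e))%:E)%E.
    rewrite leNgt; apply/negP => lt; apply: nkk; split.
      rewrite (lt_le_trans _ (gpi i dl))// -(fineK gx) -EFinD.
      by rewrite lte_fin ltrD2l mulrC ltr_pM2l// qe.
    rewrite -scaleNr (le_lt_trans _ lt)// -{1}(fineK gx) -EFinN -EFinD lee_fin lerD2l.
    by rewrite mulNr lerN2 (mulrC (ratr q)) ler_pM2l// ltW// qe.
  move=> s /andP[s0 sdl].
  have := scale i (s / dl) (- dl) (p 0 i - e); rewrite mulrN divfK ?gt_eqF//; apply => //.
  by rewrite divr_ge0//= ?ler_pdivrMr ?mul1r// ltW.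
have axis (e : R) : 0 < e -> exists2 dl : R, 0 < dl & forall i s, `|s| < dl ->
    (g (x + s *: delta_mx 0 i)%R <= (fine (g x) + (s * p 0 i + e * `|s|))%:E)%E.
  move=> e0.
  have /choice[dl dlP] : forall i, exists dl : R, 0 < dl /\ forall s, `|s| < dl ->
      (g (x + s *: delta_mx 0 i)%R <= (fine (g x) + (s * p 0 i + e * `|s|))%:E)%E.
    move=> i; have [a a0 aP] := right i e e0; have [b b0 bP] := left i e e0.
    exists (Num.min a b); split; first by rewrite lt_min a0.
    move=> s; rewrite lt_min => /andP[sa sb].
    have [s0|/ltW s0] := leP 0 s.
      rewrite ger0_norm//; rewrite ger0_norm// in sa.
      by have := aP s; rewrite s0 sa mulrDr (mulrC s e); exact.
    rewrite ler0_norm//; rewrite ler0_norm// in sb.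
    have := bP (- s); rewrite sb oppr_ge0 s0 opprK => /(_ isT).
    by rewrite mulrBr mulrN (mulrC s e).
  exists (\big[Num.min/1]_i dl i).
    by apply: lt_bigmin => // i _; have [] := dlP i.
  move=> i s sdl; apply: (dlP i).2; rewrite (lt_le_trans sdl)//.
  exact: bigmin_le.
have upper (e : R) : 0 < e -> exists2 dl : R, 0 < dl & forall h, `|h| < dl ->
    (g (x + h)%R <= (fine (g x) + (dotv p h + e * `|h|))%:E)%E.
  move=> e0.
  have e20 : 0 < e / n.+1%:R by rewrite divr_gt0.
  have [dl dl0 dlP] := axis _ e20.
  exists (dl / n.+1%:R); first by rewrite divr_gt0.
  move=> h hdl.
  pose N : R := n.+1%:R.
  have N0 : 0 < N by [].
  (* [x + h] is the average of [x] and its [n] displacements by [N * h 0 j] along the axes; the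
     factor [N] is the reason for dividing both [e] and [dl] by [n.+1]. *)
  pose y (i : 'I_n.+1) := if unlift ord0 i is Some j then x + (N * h 0 j) *: delta_mx 0 j else x.
  pose r (i : 'I_n.+1) := if unlift ord0 i is Some j
    then fine (g x) + (N * h 0 j * p 0 j + e / n.+1%:R * `|N * h 0 j|) else fine (g x).
  have /(@econvex_average g n y r gNy gc) : forall i, (g (y i) <= (r i)%:E)%E.
    move=> i; rewrite /y /r; case: unliftP => [j _|_]; last by rewrite fineK.
    apply: dlP; rewrite normrM gtr0_norm// mulrC -ltr_pdivlMr//.
    exact: le_lt_trans (coord_le_norm _ _) hdl.
  have -> : n.+1%:R^-1 *: \sum_i y i = x + h.
    rewrite big_ord_recl /y unlift_none.
    under eq_bigr do rewrite liftK.
    rewrite big_split/= sumr_const card_ord addrA -mulrS scalerDr -[x *+ n.+1]scaler_nat.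
    rewrite scalerA mulVf// scale1r; congr (_ + _).
    apply/rowP => j; rewrite mxE summxE (bigD1 j)//= big1 => [|k kj].
      by rewrite !mxE !eqxx mulr1 addr0 mulrA mulVf// mul1r.
    by rewrite !mxE eqxx eq_sym (negbTE kj) mulr0.
  move=> /le_trans; apply; rewrite lee_fin big_ord_recl /r unlift_none.
  under eq_bigr do rewrite liftK.
  rewrite big_split/= sumr_const card_ord addrA -mulrS.
  rewrite -[fine (g x) *+ n.+1]mulr_natl mulrDr mulrA mulVf// mul1r lerD2l big_split/= mulrDr lerD//.
    rewrite mulr_sumr /dotv ler_sum// => i _.
    by rewrite !mulrA mulVf// mul1r mulrC.
  rewrite mulr_sumr.
  have -> : e * `|h| = \sum_(i < n.+1) (e / n.+1%:R * `|h|).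
    by rewrite sumr_const card_ord -[_ *+ n.+1]mulr_natr mulrAC divfK.
  rewrite [leRHS]big_ord_recl/= -[leLHS]add0r lerD//.
    by rewrite mulr_ge0// ltW.
  apply: ler_sum => i _.
  rewrite normrM gtr0_norm// [leLHS]mulrCA ler_pM2l// mulrA mulVf// mul1r.
  exact: coord_le_norm.
apply/egradP => e e0; have [dl dl0 dlP] := upper e e0.
exists dl => // h hdl; have up := dlP h hdl.
have gxh : g (x + h) \is a fin_num.
  by rewrite fin_numElt gNy (le_lt_trans up)// ltry.
split=> //.
have := gp (x + h); rewrite addrAC subrr add0r.
move: up; rewrite -{1 2}(fineK gxh) -{2}(fineK gx) -EFinD !lee_fin => up low.
have eh : 0 <= e * `|h| by rewrite mulr_ge0// ltW.
by rewrite ler_norml; apply/andP; split; lra.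
Qed.

End convex_gradient.

Lemma measurable_kink {R : realType} {n k} (g : Rv R n * Rv R k -> \bar R) i q :
  measurable_fun setT g ->
  measurable [set p : Rv R n * Rv R k | kink (fun x => g (x, p.2)) i q p.1].
Proof.
move=> mg.
have msh (s : R) : measurable_fun setT (fun p : Rv R n * Rv R k =>
    g ((p.1 : 'rV[R]_n) + s *: delta_mx 0 i, p.2)).
  apply: (measurableT_comp mg); apply: measurable_fun_pair => //.
  exact: measurable_addv.
pose s l : R := l.+1%:R^-1.
rewrite (_ : mkset _ = [set p | (g p < +oo)%E] `&` \bigcap_l (
   [set p : Rv R n * Rv R k | (g p + (ratr q * s l)%:E < g (((p.1 : 'rV[R]_n) + s l *: delta_mx 0 i)%R, p.2))%E] `&`
   [set p : Rv R n * Rv R k | (g p - (ratr q * s l)%:E < g (((p.1 : 'rV[R]_n) - s l *: delta_mx 0 i)%R, p.2))%E])).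
  apply: measurableI; first exact: measurable_ltE.
  apply: bigcapT_measurable => l; apply: measurableI; apply: measurable_ltE => //.
  - exact: emeasurable_funD.
  - exact: emeasurable_funB.
  - by under eq_fun do rewrite -scaleNr; exact: msh.
apply/seteqP; split => -[x z] /=.
  by move=> [gx gk]; split => // l _; have [] := gk l.
by move=> [gx gk]; split => // l; have [] := gk l I.
Qed.

(** * Weighted averages *)

Lemma measurable_param_integral {R : realType} d1 d2 (T1 : measurableType d1)
    (T2 : measurableType d2) (mu : probability T1 R) (f : T1 * T2 -> \bar R) :
  measurable_fun setT f -> measurable_fun setT (fun y => (\int[mu]_x f (x, y))%E).
Proof.
move=> mf.
rewrite (_ : (fun _ => _) = fubini_G mu (f^\+)%E \- fubini_G mu (f^\-)%E)%E; last first.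
  apply/funext => y /=; rewrite integralE /fubini_G; congr (_ - _)%E;
  by apply: eq_integral => x _; rewrite !(funeposE, funenegE).
apply: emeasurable_funB.
- by apply: measurable_fun_fubini_tonelli_G => //; exact: measurable_funepos.
- by apply: measurable_fun_fubini_tonelli_G => //; exact: measurable_funeneg.
Qed.

Section weighted_average.
Context {R : realType} {d} {T : measurableType d} (mu : probability T R).
Variables (B : set T) (w : T -> R).
Hypotheses (mB : measurable B) (B0 : (0 < mu B)%E) (mw : measurable_fun setT w)
  (w0 : forall t, 0 < w t) (w1 : forall t, w t <= 1).
Implicit Types h : T -> R.

Definition wavg h : R :=
  (\int[mu]_(t in B) (w t * h t)) / (\int[mu]_(t in B) w t).

(** Boundedness is asked of the product with the weight only: [h] itself may fail to be
    integrable. *)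
Definition wbounded h :=
  measurable_fun setT h /\ exists C, forall t, B t -> `|w t * h t| <= C.

Lemma wbounded_integrable h : wbounded h ->
  mu.-integrable B (EFin \o (fun t => w t * h t)).
Proof.
move=> [mh [C hC]]; apply: measurable_bounded_integrable => //.
- by rewrite (le_lt_trans (probability_le1 _ mB))// ltry.
- by apply: measurable_funTS; exact: measurable_funM.
- exists C; split; first exact: num_real.
  by move=> x Cx t Bt /=; exact: le_trans (hC t Bt) (ltW Cx).
Qed.

Lemma wbounded_cst c : wbounded (fun=> c).
Proof.
split=> //; exists `|c| => t _.
by rewrite normrM (gtr0_norm (w0 t)) ler_piMl.
Qed.

Lemma wboundedD h1 h2 : wbounded h1 -> wbounded h2 -> wbounded (fun t => h1 t + h2 t).
Proof.
move=> [m1 [C1 H1]] [m2 [C2 H2]]; split; first exact: measurable_funD.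
exists (C1 + C2) => t Bt; rewrite mulrDr (le_trans (ler_normD _ _))//.
by rewrite lerD// ?H1 ?H2.
Qed.

Lemma wboundedZ c h : wbounded h -> wbounded (fun t => c * h t).
Proof.
move=> [m1 [C1 H1]]; split; first exact: measurable_funM.
by exists (`|c| * C1) => t Bt; rewrite mulrCA normrM ler_wpM2l// H1.
Qed.

Lemma wbounded_sum (I : finType) (h : I -> T -> R) : (forall i, wbounded (h i)) ->
  wbounded (fun t => \sum_i h i t).
Proof.
move=> hb; elim: (index_enum I) => [|i s ih].
  by under eq_fun do rewrite big_nil; exact: wbounded_cst.
by under eq_fun do rewrite big_cons; exact: wboundedD.
Qed.

Lemma wmass_gt0 : 0 < \int[mu]_(t in B) w t.
Proof.
have wI : mu.-integrable B (EFin \o w).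
  have := wbounded_integrable _ (wbounded_cst 1).
  by apply: eq_integrable => // t _ /=; rewrite mulr1.
rewrite lt_neqAle Rintegral_ge0 ?andbT; last by move=> t _; exact: ltW.
apply/eqP => /esym W0.
have : (\int[mu]_(t in B) `|(w t)%:E| = 0)%E.
  under eq_integral => t _ do rewrite gee0_abs ?lee_fin ?(ltW (w0 t))//.
  by rewrite -(fineK (integrable_fin_num _ wI))//; congr EFin.
have mwB : measurable_fun B (EFin \o w) by exact/measurable_EFinP/measurable_funTS.
move=> /(ae_eq_integral_abs mu mB mwB)[N [mN N0 BN]].
move: B0; rewrite lt_neqAle => /andP[/eqP + _]; apply; apply/esym.
apply: (subset_measure0 _ _ _ N0) => // t Bt; apply: BN => /= /(_ Bt)[] wt0.
by have := w0 t; rewrite wt0 ltxx.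
Qed.

Lemma wavgD h1 h2 : wbounded h1 -> wbounded h2 ->
  wavg (fun t => h1 t + h2 t) = wavg h1 + wavg h2.
Proof.
move=> b1 b2; rewrite /wavg -mulrDl -RintegralD//; try exact: wbounded_integrable.
by congr (_ / _); apply: eq_Rintegral => t _; rewrite mulrDr.
Qed.

Lemma wavgZ c h : wbounded h -> wavg (fun t => c * h t) = c * wavg h.
Proof.
move=> b; rewrite /wavg mulrA -RintegralZl//; last exact: wbounded_integrable.
by congr (_ / _); apply: eq_Rintegral => t _; rewrite mulrCA.
Qed.

Lemma wavg_cst c : wavg (fun=> c) = c.
Proof.
rewrite -[c]mulr1 wavgZ; last exact: wbounded_cst.
rewrite /wavg; under eq_Rintegral do rewrite mulr1.
by rewrite divff// gt_eqF// wmass_gt0.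
Qed.

Lemma wavg_sum (I : finType) (h : I -> T -> R) : (forall i, wbounded (h i)) ->
  wavg (fun t => \sum_i h i t) = \sum_i wavg (h i).
Proof.
move=> hb; elim: (index_enum I) => [|i s ih].
  rewrite big_nil -[RHS](wavg_cst 0); congr wavg.
  by apply/funext => t; rewrite big_nil.
rewrite big_cons -ih -wavgD//; last first.
  elim: s {ih} => [|j s ih].
    by under eq_fun do rewrite big_nil; exact: wbounded_cst.
  by under eq_fun do rewrite big_cons; exact: wboundedD.
by congr wavg; apply/funext => t; rewrite big_cons.
Qed.

Lemma wavg_ge0 h : wbounded h -> {ae mu, forall t, B t -> 0 <= h t} -> 0 <= wavg h.
Proof.
move=> hb h0; rewrite /wavg divr_ge0//; last exact/ltW/wmass_gt0.
rewrite /Rintegral (ae_eq_integral (fun t => `|w t * h t|%:E))//.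
- by rewrite fine_ge0// integral_ge0// => t _; rewrite lee_fin.
- by have /integrableP[] := wbounded_integrable _ hb.
- apply/measurable_EFinP/measurableT_comp => //.
  by apply: measurable_funTS; apply: measurable_funM => //; case: hb.
- apply: filterS h0 => t h0 Bt; rewrite /= ger0_norm//.
  by rewrite mulr_ge0// ?h0// ltW.
Qed.

Lemma wavg_le h c : wbounded h -> {ae mu, forall t, B t -> h t <= c} -> wavg h <= c.
Proof.
move=> hb hc; rewrite -subr_ge0 -[X in X - _](wavg_cst c) -mulN1r -wavgZ//.
rewrite -wavgD; [|exact: wbounded_cst|exact: wboundedZ].
apply: wavg_ge0; first by apply: wboundedD; [exact: wbounded_cst|exact: wboundedZ].
by apply: filterS hc => t hc Bt; rewrite mulN1r subr_ge0 hc.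
Qed.

Lemma wavg_ge h c : wbounded h -> {ae mu, forall t, B t -> c <= h t} -> c <= wavg h.
Proof.
move=> hb hc; rewrite -subr_ge0 -[X in _ - X](wavg_cst c) -mulN1r -wavgZ//; last exact: wbounded_cst.
rewrite -wavgD//; last by apply: wboundedZ; exact: wbounded_cst.
apply: wavg_ge0; first by apply: wboundedD => //; apply: wboundedZ; exact: wbounded_cst.
by apply: filterS hc => t hc Bt; rewrite mulN1r subr_ge0 hc.
Qed.

End weighted_average.

(** * The chain potential *)

Section chain_potential.
Context {R : realType} {d k : nat} (FU : probability (Rv R d) R).
Variable Q : 'rV[R]_d * 'rV[R]_k -> 'rV[R]_d.
Hypothesis mQ : measurable_fun setT (Q : Rv R d * Rv R k -> Rv R d).

(** Averages over these balls have a nonzero denominator, and every rational ball around almost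
    every point is of this kind. The type stays countable. *)
Definition node := {j : 'rV[rat]_d * nat | (0 < FU (ratball j))%E}.
Implicit Types (j : node) (s : seq node) (z : 'rV[R]_k) (x u v : 'rV[R]_d).

Definition nodeball j : set (Rv R d) := ratball (val j).

Lemma measurable_nodeball j : measurable (nodeball j).
Proof. exact: measurable_ratball. Qed.

(* This weight makes [Q] bounded, so that its averages exist without any integrability. *)
Definition weight z v : R := (1 + `|\sum_i `|Q (v, z) 0 i| |)^-1.

Lemma weight_gt0 z v : 0 < weight z v.
Proof. by rewrite invr_gt0 ltr_pwDl. Qed.

Lemma weight_le1 z v : weight z v <= 1.
Proof. by rewrite invf_le1 ?lerDl// ltr_pwDl. Qed.

Lemma weight_Q_le1 z v i : weight z v * `|Q (v, z) 0 i| <= 1.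
Proof.
rewrite mulrC ler_pdivrMr ?ltr_pwDl// mul1r.
rewrite (@le_trans _ _ `|\sum_i `|Q (v, z) 0 i| |)// ?lerDr//.
rewrite [leRHS]ger0_norm ?sumr_ge0// (bigD1 i)//= lerDl sumr_ge0//.
Qed.

Lemma measurable_weight2 :
  measurable_fun setT (fun p : Rv R d * Rv R k => weight p.2 p.1).
Proof.
have cinv : continuous (fun t : R => (1 + `|t|)^-1).
  move=> t; apply: cvgV; first by rewrite gt_eqF// ltr_pwDl.
  by apply: cvgD; [exact: cvg_cst|exact: norm_continuous].
apply: (measurableT_comp (continuous_measurable_fun cinv)).
apply: measurable_sum => i; apply: measurableT_comp => //.
apply: (@measurable_coord_comp _ _ _ _ (fun p : Rv R d * Rv R k => Q (p.1, p.2)) i).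
by under eq_fun do rewrite -surjective_pairing.
Qed.

Lemma measurable_section z (d' : measure_display) (T : measurableType d') (g : Rv R d * Rv R k -> T) :
  measurable_fun setT g -> measurable_fun setT (fun v : Rv R d => g (v, z)).
Proof.
by move=> mg; apply: (measurableT_comp mg); exact: measurable_fun_pair.
Qed.

Lemma measurable_weight z : measurable_fun setT (weight z : Rv R d -> R).
Proof. exact: (measurable_section z _ _ _ measurable_weight2). Qed.

Lemma mass_gt0 j z : 0 < \int[FU]_(v in nodeball j) weight z v.
Proof.
apply: wmass_gt0.
- exact: measurable_nodeball.
- by case: j.
- exact: (measurable_weight z).
- exact: weight_gt0.
- exact: weight_le1.
Qed.

Definition avg j z (h : 'rV[R]_d -> R) : R := wavg FU (nodeball j) (weight z) h.
Definition avgbounded j z (h : 'rV[R]_d -> R) := wbounded (nodeball j) (weight z : Rv R d -> R) h.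

Lemma nodeball_bounded j : exists C : R, forall v, nodeball j v -> forall i, `|v 0 i| <= C.
Proof.
exists (\sum_i `|ratr ((val j).1 0 i)| + (val j).2.+1%:R^-1) => v vj i.
rewrite -[v 0 i](subrK (ratr ((val j).1 0 i))) addrC (le_trans (ler_normD _ _))//.
rewrite lerD//; last exact/ltW/vj.
by rewrite (bigD1 i)//= lerDl sumr_ge0.
Qed.

Lemma avgbounded_Q j z i : avgbounded j z (fun v => Q (v, z) 0 i).
Proof.
split; first exact: (measurable_coord_comp _ i (measurable_section z _ _ _ mQ)).
by exists 1 => v _; rewrite normrM gtr0_norm ?weight_gt0// weight_Q_le1.
Qed.

Lemma avgbounded_id j z i : avgbounded j z (fun v => v 0 i).
Proof.
split; first exact: measurable_coord.
have [C vC] := nodeball_bounded j; exists C => v vj.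
rewrite normrM gtr0_norm ?weight_gt0// (le_trans _ (vC _ vj i))//.
by rewrite ler_piMl// weight_le1.
Qed.

Lemma avgbounded_dotQ j z : avgbounded j z (fun v => dotv (Q (v, z)) v).
Proof.
apply: wbounded_sum => [v|v|i]; [exact: weight_gt0|exact: weight_le1|].
split.
  apply: measurable_funM; first exact: (avgbounded_Q j z i).1.
  exact: measurable_coord.
have [C vC] := nodeball_bounded j; exists C => v vj.
rewrite mulrA normrM -[leRHS]mul1r ler_pM//; last exact: vC.
by rewrite normrM gtr0_norm ?weight_gt0// weight_Q_le1.
Qed.

Definition Qbar j z : 'rV[R]_d := \row_i avg j z (fun v => Q (v, z) 0 i).
Definition vbar j z : 'rV[R]_d := \row_i avg j z (fun v => v 0 i).
Definition Qvbar j z : R := avg j z (fun v => dotv (Q (v, z)) v).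

Lemma measurable_avg j (h : Rv R d * Rv R k -> R) : measurable_fun setT h ->
  measurable_fun setT (fun z : Rv R k => avg j z (fun v => h (v, z))).
Proof.
move=> mh.
have main (g : Rv R d * Rv R k -> R) : measurable_fun setT g ->
    measurable_fun setT (fun z : Rv R k => \int[FU]_(v in nodeball j) g (v, z)).
  move=> mg; under eq_fun do rewrite Rintegral_mkcond.
  apply: measurableT_comp; first exact: fine_measurable.
  pose g' (p : Rv R d * Rv R k) := (\1_(nodeball j) p.1 * g p)%:E.
  rewrite (_ : (fun _ => _) = (fun z => \int[FU]_v g' (v, z)))%E; last first.
    apply/funext => z; apply: eq_integral => v _; rewrite /g'/= /patch indicE.
    by case: ifPn => _; rewrite ?mul1r ?mul0r.
  apply: measurable_param_integral; apply/measurable_EFinP.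
  apply: measurable_funM => //.
  have m1 : measurable_fun setT (\1_(nodeball j) : Rv R d -> R).
    by apply: measurable_indic; exact: measurable_nodeball.
  exact: measurableT_comp m1 _.
apply: measurable_funM.
  by apply: (main (fun p => weight p.2 p.1 * h p)); apply: measurable_funM => //;
    exact: measurable_weight2.
pose W (z : Rv R k) := \int[FU]_(v in nodeball j) weight z v.
have mW : measurable_fun setT W by exact: (main _ measurable_weight2).
(* Since the mass is positive, its inverse is a value of [powR], which is measurable. *)
have -> : (fun z : Rv R k => (\int[FU]_(v in nodeball j) weight z v)^-1) =
    (@powR R ^~ (-1)) \o W.
  by apply/funext => z; rewrite /= powR_inv1// ltW// mass_gt0.
by apply: measurableT_comp mW; exact: measurable_powR.
Qed.

Lemma avg_dotQ j z x : avg j z (fun v => dotv (Q (v, z)) x) = dotv (Qbar j z) x.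
Proof.
rewrite /avg wavg_sum; [|exact: measurable_nodeball|by case: j|exact: (measurable_weight z)|exact: weight_gt0|exact: weight_le1|].
  apply: eq_bigr => i _; rewrite mxE mulrC -wavgZ; [|exact: measurable_nodeball|exact: (measurable_weight z)|exact: avgbounded_Q].
  by congr wavg; apply/funext => v; rewrite mulrC.
by move=> i; under eq_fun do rewrite mulrC; apply: wboundedZ; exact: avgbounded_Q.
Qed.

Lemma avg_dot j z a : avg j z (fun v => dotv a v) = dotv a (vbar j z).
Proof.
rewrite /avg wavg_sum; [|exact: measurable_nodeball|by case: j|exact: (measurable_weight z)|exact: weight_gt0|exact: weight_le1|].
  apply: eq_bigr => i _; rewrite mxE -wavgZ//; [exact: measurable_nodeball|exact: (measurable_weight z)|exact: avgbounded_id].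
by move=> i; apply: wboundedZ; exact: avgbounded_id.
Qed.

Lemma avgbounded_affine j z x a (b : R) :
  avgbounded j z (fun v => dotv (Q (v, z)) (x - v) + (dotv a v + b)).
Proof.
have w0 := weight_gt0 z; have w1 := weight_le1 z.
apply: wboundedD; last first.
  apply: wboundedD; last exact: wbounded_cst.
  by apply: wbounded_sum => // i; apply: wboundedZ; exact: avgbounded_id.
under eq_fun do rewrite dotvBr -mulN1r.
apply: wboundedD; last by apply: wboundedZ; exact: avgbounded_dotQ.
apply: wbounded_sum => // i; under eq_fun do rewrite mulrC.
by apply: wboundedZ; exact: avgbounded_Q.
Qed.

(** Averaging keeps a chain affine in [x], with coefficients depending on [z] alone; hence a chain
    can be stored as a slope and a constant, both Borel in [z]. *)
Lemma avg_affine j z x a (b : R) :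
  avg j z (fun v => dotv (Q (v, z)) (x - v) + (dotv a v + b)) =
  dotv (Qbar j z) x - Qvbar j z + (dotv a (vbar j z) + b).
Proof.
have w0 := weight_gt0 z; have w1 := weight_le1 z.
have mw := measurable_weight z; have mj := measurable_nodeball j.
have j0 : (0 < FU (nodeball j))%E by case: j {mj}.
have bx : avgbounded j z (fun v => dotv (Q (v, z)) x).
  by apply: wbounded_sum => // i; under eq_fun do rewrite mulrC; apply: wboundedZ; exact: avgbounded_Q.
have ba : avgbounded j z (fun v => dotv a v).
  by apply: wbounded_sum => // i; apply: wboundedZ; exact: avgbounded_id.
have bN : avgbounded j z (fun v => -1 * dotv (Q (v, z)) v).
  by apply: wboundedZ; exact: avgbounded_dotQ.
rewrite -avg_dotQ -avg_dot -[b in RHS](@wavg_cst _ _ _ FU (nodeball j) (weight z))//.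
rewrite -mulN1r /avg /Qvbar -wavgZ//; last exact: avgbounded_dotQ.
rewrite -wavgD// -[X in _ = _ + X]wavgD//; last exact: wbounded_cst.
rewrite -wavgD//; [|exact: wboundedD|by apply: wboundedD => //; exact: wbounded_cst].
by congr wavg; apply/funext => v; rewrite dotvBr mulN1r.
Qed.

Variable j0 : node.

(** The list runs from the last ball of the chain back towards the base ball [j0], which is implicit
    at its end; only the last ball determines the slope. *)
Definition cslope s z : 'rV[R]_d := Qbar (head j0 s) z.
Fixpoint cconst s z : R :=
  if s is j :: s' then - Qvbar j z + (dotv (cslope s' z) (vbar j z) + cconst s' z)
  else - Qvbar j0 z.
(** Rockafellar's sum of the terms [<Q (v_i, z), v_(i+1) - v_i>], ending with [x], in which each
    [v_i] is averaged over its ball. *)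
Definition chain s z x : R := dotv (cslope s z) x + cconst s z.

Lemma chain_nil z x :
  chain [::] z x = avg j0 z (fun v => dotv (Q (v, z)) (x - v) + (dotv 0 v + 0)).
Proof.
have dot0 y : dotv 0 y = 0 :> R by rewrite /dotv big1// => i _; rewrite mxE mul0r.
by rewrite avg_affine dot0 !addr0.
Qed.

(** The form used in all estimates: an inequality valid for almost every [v] in the ball [j] passes
    to the longer chain. *)
Lemma chain_cons j s z x : chain (j :: s) z x =
  avg j z (fun v => dotv (Q (v, z)) (x - v) + chain s z v).
Proof. by rewrite /chain avg_affine/= addrA. Qed.

Lemma measurable_Qbar j : measurable_fun setT (Qbar j : Rv R k -> Rv R d).
Proof.
apply: measurable_rVP => i; under eq_fun do rewrite mxE.
apply: (measurable_avg j (fun p => Q p 0 i)).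
exact: measurable_coord_comp.
Qed.

Lemma measurable_vbar j : measurable_fun setT (vbar j : Rv R k -> Rv R d).
Proof.
apply: measurable_rVP => i; under eq_fun do rewrite mxE.
apply: (measurable_avg j (fun p => (p.1 : 'rV[R]_d) 0 i)).
exact: measurable_coord_comp.
Qed.

Lemma measurable_Qvbar j : measurable_fun setT (Qvbar j : Rv R k -> R).
Proof.
apply: (measurable_avg j (fun p => dotv (Q p) p.1)).
exact: measurable_dotv.
Qed.

Lemma measurable_cconst s : measurable_fun setT (cconst s : Rv R k -> R).
Proof.
elim: s => [|j s ih]/=; first by apply: measurableT_comp => //; exact: measurable_Qvbar.
apply: measurable_funD; first by apply: measurableT_comp => //; exact: measurable_Qvbar.
apply: measurable_funD => //; apply: measurable_dotv; last exact: measurable_vbar.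
exact: measurable_Qbar.
Qed.

Definition potential (p : 'rV[R]_d * 'rV[R]_k) : \bar R :=
  ereal_sup [set (chain s p.2 p.1)%:E | s in [set: seq node]].

Lemma measurable_potential :
  measurable_fun setT (potential : Rv R d * Rv R k -> \bar R).
Proof.
apply: measurable_countable_esup => s; apply/measurable_EFinP.
apply: measurable_funD; last exact: (measurableT_comp (measurable_cconst s)).
apply: measurable_dotv => //.
exact: (measurableT_comp (measurable_Qbar (head j0 s))).
Qed.

Lemma potential_gtNy p : (-oo < potential p)%E.
Proof.
apply: (@lt_le_trans _ _ (chain [::] p.2 p.1)%:E); first by rewrite ltNyr.
by apply: ereal_sup_ubound; exists [::].
Qed.

Section at_point.
Variables (z : 'rV[R]_k) (f : 'rV[R]_d -> \bar R).
Hypotheses (fNy : forall u, (-oo < f u)%E)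
  (fQ : {ae FU, forall v, f v \is a fin_num /\ subgrad f v (Q (v, z))}).

(** By induction on the chain: the bound at [v] added to the subgradient inequality from [v] to [x]
    gives the bound at [x], for almost every [v], and averaging preserves it. *)
Lemma chain_le (c : R) : (forall v, nodeball j0 v -> (c%:E <= f v)%E) ->
  forall s x, ((chain s z x + c)%:E <= f x)%E.
Proof.
have w0 := weight_gt0 z; have w1 := weight_le1 z; have mw := measurable_weight z.
move=> cf; elim=> [|j s ih] x.
  have [->|fx] := eqVneq (f x) +oo%E; first by rewrite leey.
  have fxf : f x \is a fin_num by rewrite fin_numE gt_eqF//= fx.
  rewrite chain_nil -(fineK fxf) lee_fin -lerBrDr.
  apply: wavg_le => //; [exact: measurable_nodeball|by case: j0|exact: avgbounded_affine|].
  apply: aeS fQ => v [fv fvQ] jv; have := cf v jv; have := fvQ x.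
  have -> : dotv 0 v = 0 :> R by rewrite /dotv big1// => i _; rewrite mxE mul0r.
  rewrite -(fineK fxf) -(fineK fv) -EFinD !lee_fin !addr0.
  by lra.
have [->|fx] := eqVneq (f x) +oo%E; first by rewrite leey.
have fxf : f x \is a fin_num by rewrite fin_numE gt_eqF//= fx.
rewrite chain_cons -(fineK fxf) lee_fin -lerBrDr.
apply: wavg_le => //; [exact: measurable_nodeball|by case: j|exact: avgbounded_affine|].
apply: aeS fQ => v [fv fvQ] jv; have := ih v; have := fvQ x.
rewrite -(fineK fxf) -(fineK fv) -EFinD !lee_fin.
by lra.
Qed.

(** Any one subgradient of [f] gives an affine minorant, which is bounded below on the bounded base
    ball. The potential is thus finite wherever [f] is. *)
Lemma potential_le : exists c : R, forall x, (potential (x, z) + c%:E <= f x)%E.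
Proof.
have [v0 [f0 fQ0]] : exists v, f v \is a fin_num /\ subgrad f v (Q (v, z)).
  exact: ae_ex fQ.
have [C vC] := nodeball_bounded j0.
have [c cP] : exists c : R, forall v, nodeball j0 v -> (c%:E <= f v)%E.
  pose K := \sum_i `|Q (v0, z) 0 i| * (C + `|v0 0 i|).
  exists (fine (f v0) - K) => v jv; apply: le_trans (fQ0 v).
  rewrite -(fineK f0) -EFinD lee_fin lerD2l lerNl -dotvNr opprB.
  apply: ler_sum => i _; rewrite (le_trans (ler_norm _))// normrM ler_wpM2l//.
  rewrite !mxE (le_trans (ler_normB _ _))// addrC lerD2r.
  exact: vC.
exists c => x; rewrite -leeBrDr//; apply: ge_ereal_sup => _ [s _ <-].
by rewrite leeBrDr// -EFinD chain_le.
Qed.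

(** Subgradients near a point of differentiability are close to the gradient. The inequality at [v]
    is tested at [v] shifted by [t] along an axis, and compared with the expansion at [u]. *)
Lemma gradient_continuous u (e : R) : 0 < e -> subgrad f u (Q (u, z)) ->
  egrad f u (Q (u, z)) ->
  exists2 dl : R, 0 < dl & forall v, `|v - u| <= dl ->
    f v \is a fin_num -> subgrad f v (Q (v, z)) ->
    forall i, `|Q (v, z) 0 i - Q (u, z) 0 i| <= e.
Proof.
move=> e0 sub /[dup] /egrad_fin_num fu /egradP.
have e20 : 0 < e / 2 by rewrite divr_gt0.
move=> /(_ _ e20)[r r0 rP].
(* The test displacement [h] from [u] has norm at most [2 * t], which is less than [r], and its
   error [e / 2 * (2 * t)] equals [e * t]. *)
pose t := r / 4; have t0 : 0 < t by rewrite divr_gt0.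
exists t => // v vu fv fvQ i.
have key (sg : R) : `|sg| = 1 -> sg * (Q (v, z) 0 i - Q (u, z) 0 i) <= e.
  move=> sg1; pose h := v - u + (sg * t) *: delta_mx 0 i.
  have hle : `|h| <= 2 * t.
    rewrite (le_trans (ler_normD _ _))// mulr2n mulrDl mul1r lerD//.
    rewrite normrZ normrM sg1 mul1r (gtr0_norm t0) ler_piMr ?(ltW t0)//.
    apply: norm_le_coord => // j; rewrite mxE eqxx/=.
    by case: (j == i); rewrite ?normr1 ?normr0.
  have [|fh] := rP h; first by rewrite (le_lt_trans hle)// /t; lra.
  rewrite ler_norml => /andP[_ up].
  have := fvQ (u + h); have := sub v.
  have -> : u + h - v = (sg * t) *: delta_mx 0 i.
    by rewrite /h addrA addrCA subrr addr0 addrAC subrr add0r.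
  rewrite -(fineK fu) -(fineK fv) -(fineK fh) -!EFinD !lee_fin dotvZr dotv_delta => l1 l2.
  move: up; rewrite /h dotvDr dotvZr dotv_delta -/h => up.
  have : e / 2 * `|h| <= e / 2 * (2 * t) by rewrite ler_pM2l.
  move=> eh; rewrite -(ler_pM2r t0).
  move: l1 l2 up eh; set A := Q (v, z) 0 i; set B := Q (u, z) 0 i.
  by move=> *; lra.
rewrite ler_norml; apply/andP; split.
  by rewrite lerNl -mulN1r; apply: key; rewrite normrN1.
by rewrite -[leLHS]mul1r; apply: key; rewrite normr1.
Qed.

(** Prepending to a chain [s] a small charged ball around [u] gives a chain whose value at [x] is at
    least [<Q (u, z), x - u> + chain s z u] minus [e]. *)
Lemma potential_subgrad u : egrad f u (Q (u, z)) -> subgrad f u (Q (u, z)) ->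
  (forall i : 'rV[rat]_d * nat, ratball i u -> FU (ratball i) != 0%E) ->
  subgrad (fun x => potential (x, z)) u (Q (u, z)).
Proof.
have w0 := weight_gt0 z; have w1 := weight_le1 z; have mw := measurable_weight z.
move=> fu sub uj x; set qu := Q (u, z) in fu sub *; rewrite -leeBrDr//; apply: ge_ereal_sup => _ [s _ <-].
rewrite leeBrDr// -EFinD; apply/lee_addgt0Pr => e e0.
(* The three errors [b1], [b2], [b3] below add up to at most [eta * (K - 1)]; the final 1 makes [K]
   positive. *)
pose K : R := d%:R * (`|x - u| + 1 + `|qu| + `|cslope s z|) + 1.
have K0 : 0 < K by rewrite ltr_wpDl// mulr_ge0// !addr_ge0.
pose eta := Num.min 1 (e / K).
have eta0 : 0 < eta by rewrite lt_min ltr01 divr_gt0.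
have eta1 : eta <= 1 by rewrite ge_min lexx.
have etaK : eta * K <= e by rewrite -ler_pdivlMr// ge_min lexx orbT.
have [dl dl0 dlP] := gradient_continuous u eta eta0 sub fu.
(* Within [dl] the values of [Q] stay [eta]-close to [qu], and within [eta] the point [v] itself is
   close to [u]. *)
pose r := Num.min dl eta.
have r0 : 0 < r by rewrite lt_min dl0.
have [j [ju jr]] : exists i : 'rV[rat]_d * nat, ratball i u /\ ratball i `<=` ball u r.
  by apply: ratball_base; [exact: ball_open|exact: ballxx].
have Fj : (0 < FU (ratball j))%E by rewrite lt_neqAle measure_ge0 andbT eq_sym uj.
pose J : node := exist _ j Fj.
apply: (@le_trans _ _ ((chain (J :: s) z x)%:E + e%:E)%E); last first.
  by rewrite leeD2r//; apply: ereal_sup_ubound; exists (J :: s).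
rewrite -EFinD lee_fin -lerBlDr chain_cons.
apply: wavg_ge => //; [exact: measurable_nodeball|exact: avgbounded_affine|].
apply: aeS fQ => v [fv fvQ] jv.
have := jr v jv; rewrite -ball_normE /= lt_min => /andP[/ltW vdl /ltW veta].
have {}dlP := dlP v _ fv fvQ; rewrite distrC in dlP; have {}dlP := dlP vdl.
set qv := Q (v, z) in dlP *; rewrite -/qu in dlP.
have nq : `|qv - qu| <= eta.
  by apply: norm_le_coord => [|i]; rewrite ?(ltW eta0)// !mxE.
have E : dotv qu (x - u) + chain s z u - (dotv qv (x - v) + chain s z v) =
    dotv (qu - qv) (x - v) + dotv qu (v - u) + dotv (cslope s z) (u - v).
  by rewrite /chain !dotvBl !dotvBr; ring.
rewrite lerBlDr -lerBlDl (addrC (chain s z u)) E.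
have b1 : dotv (qu - qv) (x - v) <= eta * (d%:R * (`|x - u| + 1)).
  rewrite (le_trans (ler_norm _))// (le_trans (dotv_norm_le _ _))//.
  rewrite [leRHS]mulrCA ler_wpM2l// ler_pM// ?(distrC qu)//.
  rewrite -(subrKA u) (le_trans (ler_normD _ _))// lerD2l.
  exact: le_trans veta eta1.
have b2 : dotv qu (v - u) <= eta * (d%:R * `|qu|).
  rewrite (le_trans (ler_norm _))// (le_trans (dotv_norm_le _ _))//.
  by rewrite mulrA mulrC ler_wpM2r// ?mulr_ge0// distrC.
have b3 : dotv (cslope s z) (u - v) <= eta * (d%:R * `|cslope s z|).
  rewrite (le_trans (ler_norm _))// (le_trans (dotv_norm_le _ _))//.
  by rewrite mulrA mulrC ler_wpM2r// mulr_ge0.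
apply: le_trans etaK; rewrite /K mulrDr mulr1.
apply: (@le_trans _ _ (eta * (d%:R * (`|x - u| + 1 + `|qu| + `|cslope s z|)))).
  by rewrite !(mulrDr d%:R) in b1 *; rewrite !(mulrDr eta) in b1 *; lra.
by rewrite lerDl ltW.
Qed.

End at_point.

End chain_potential.

(** * Legendre transforms *)

Section conjugate.
Context {R : realType} {n : nat}.
Implicit Types (f g : 'rV[R]_n -> \bar R) (x y u v : 'rV[R]_n).

(** A common form for the potential and for every Legendre transform, so that convexity and lower
    semicontinuity are proved once. An index with [c i = +oo] contributes [-oo]. *)
Definition esup_affine (I : Type) (a : I -> 'rV[R]_n) (c : I -> \bar R) x : \bar R :=
  ereal_sup [set ((dotv (a i) x)%:E - c i)%E | i in [set: I]].

Definition conj g : 'rV[R]_n -> \bar R := esup_affine 'rV[R]_n id g.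

Lemma esup_affine_convex I a c : (forall i, (-oo < c i)%E) ->
  (forall x, (-oo < esup_affine I a c x)%E) -> econvex (esup_affine I a c).
Proof.
move=> cNy hNy x y t /andP[t0 t1]; apply: ge_ereal_sup => _ [i _ <-].
have [->|ciy] := eqVneq (c i) +oo%E; first by rewrite addeNy leNye.
have ci : c i \is a fin_num by rewrite fin_numE gt_eqF//= ciy.
rewrite -(fineK ci) -EFinB dotvDr !dotvZr.
rewrite (_ : _ - _ = (1 - t) * (dotv (a i) x - fine (c i)) +
  t * (dotv (a i) y - fine (c i))); last by ring.
rewrite EFinD !EFinM; apply: leeD; apply: lee_wpmul2l; rewrite ?lee_fin.
- by rewrite subr_ge0 ltW.
- by apply: ereal_sup_ubound; exists i => //; rewrite EFinB fineK.
- exact: ltW.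
- by apply: ereal_sup_ubound; exists i => //; rewrite EFinB fineK.
Qed.

Lemma esup_affine_lsc I a c : (forall i, (-oo < c i)%E) ->
  lower_semicontinuous (esup_affine I a c).
Proof.
move=> cNy x b /ereal_sup_gt[_ [i _ <-]].
have [->|ciy] := eqVneq (c i) +oo%E; first by rewrite addeNy ltNge leNye.
have ci : c i \is a fin_num by rewrite fin_numE gt_eqF//= ciy.
rewrite -(fineK ci) -EFinB lte_fin ltrBrDr => bx.
have /(_ x) := continuous_dotv (a i).
move=> /(_ [set r | b + fine (c i) < r]) /=; move=> H.
exists [set y | b + fine (c i) < dotv (a i) y].
  by apply: H; apply: lt_nbhsr.
move=> y /= by_; apply: (@lt_le_trans _ _ ((dotv (a i) y)%:E - c i)%E).
  by rewrite -(fineK ci) -EFinB lte_fin ltrBrDr.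
by apply: ereal_sup_ubound; exists i.
Qed.

Lemma conj_ge g u y : ((dotv u y)%:E - g u <= conj g y)%E.
Proof. by apply: ereal_sup_ubound; exists u. Qed.

Lemma conj_gtNy g : (exists u, (g u < +oo)%E) -> forall y, (-oo < conj g y)%E.
Proof.
move=> [u gu] y; apply: lt_le_trans (conj_ge g u y).
by case: (g u) gu => [r| |]//= _; rewrite -EFinB ltNyr.
Qed.

Lemma young g u y : (-oo < g u)%E -> (-oo < conj g y)%E ->
  ((dotv u y)%:E <= g u + conj g y)%E.
Proof.
move=> gNy cNy; have := conj_ge g u y.
case: (g u) gNy => [r| |]//; last by move=> _ _; rewrite addye ?leey// gt_eqF.
by move=> _; rewrite leeBlDl.
Qed.

Lemma biconj_le g x : (forall u, (-oo < g u)%E) -> (forall y, (-oo < conj g y)%E) ->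
  (conj (conj g) x <= g x)%E.
Proof.
move=> gNy cNy; apply: ge_ereal_sup => _ [y _ <-].
rewrite dotvC; have := young g x y (gNy x) (cNy y).
case: (conj g y) (cNy y) => [r| |]// _; last by rewrite addeNy leNye.
by rewrite leeBlDr.
Qed.

(** No separation argument is involved: the conjugate at the slope [a i] is at most [c i], so every
    affine piece already occurs below the biconjugate. *)
Lemma biconj_affine I a (c : I -> R) x :
  let g := esup_affine I a (EFin \o c) in
  (forall u, (-oo < g u)%E) -> (forall y, (-oo < conj g y)%E) ->
  g x = conj (conj g) x.
Proof.
move=> g gNy cNy; apply/eqP; rewrite eq_le; apply/andP; split; last exact: biconj_le.
apply: ge_ereal_sup => _ [i _ <-]; apply: le_trans (conj_ge (conj g) (a i) x).
rewrite leeD2l// leeN2; apply: ge_ereal_sup => _ [u _ <-] /=.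
have : ((dotv (a i) u)%:E - (c i)%:E <= g u)%E by apply: ereal_sup_ubound; exists i.
case: (g u) (gNy u) => [r| |]//= _; last by rewrite addeNy leNye.
by rewrite -!EFinB !lee_fin dotvC; lra.
Qed.

Lemma subgrad_fenchel g u p : g u \is a fin_num -> (forall x, (-oo < g x)%E) ->
  subgrad g u p -> (g u + conj g p = (dotv u p)%:E)%E.
Proof.
move=> gu gNy gp.
suff -> : conj g p = ((dotv u p)%:E - g u)%E by rewrite addeC subeK.
apply/eqP; rewrite eq_le conj_ge andbT; apply: ge_ereal_sup => _ [x _ <-] /=.
have := gp x; case: (g x) (gNy x) => [r| |]//= _; last by rewrite addeNy leNye.
by rewrite -(fineK gu) -EFinD -!EFinB !lee_fin dotvBr !(dotvC p); lra.
Qed.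

Lemma fenchel_subgrad g u p : g u \is a fin_num -> (forall x, (-oo < g x)%E) ->
  (g u + conj g p = (dotv u p)%:E)%E -> subgrad (conj g) p u.
Proof.
move=> gu gNy gp y; apply: le_trans (conj_ge g u y).
have -> : conj g p = ((dotv u p)%:E - g u)%E by rewrite -gp addeAC subee// add0e.
by rewrite -(fineK gu) -!EFinB -EFinD lee_fin dotvBr; lra.
Qed.

(** Moving from [u] slightly towards [v0] leads to the centre of a ball on which convexity bounds
    [g] by nearly [g u]; a rational point of that ball does almost as well as [u]. The supremum
    becomes countable, hence measurable in a parameter. *)
Lemma conj_rational g v0 (M r : R) : (forall x, (-oo < g x)%E) -> econvex g -> 0 < r ->
  (forall h, `|h| < r -> (g (v0 + h)%R <= M%:E)%E) ->
  forall y, conj g y = ereal_sup [set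
    ((dotv (map_mx ratr c : 'rV[R]_n) y)%:E - g (map_mx ratr c))%E | c in [set: 'rV[rat]_n]].
Proof.
move=> gNy gc r0 gM y; apply/eqP; rewrite eq_le; apply/andP; split; last first.
  by apply: ge_ereal_sup => _ [c _ <-]; exact: conj_ge.
apply: ge_ereal_sup => _ [u _ <-] /=.
have [->|guy] := eqVneq (g u) +oo%E; first by rewrite addeNy leNye.
have gu : g u \is a fin_num by rewrite fin_numE gt_eqF//= guy.
rewrite -(fineK gu) -EFinB; apply/lee_addgt0Pr => e e0.
(* [K] bounds the loss per unit of [t] when [u] is replaced by the rational point. *)
pose K : R := `|dotv (v0 - u) y| + n%:R * (r * `|y|) + `|M - fine (g u)| + 1.
have K0 : 0 < K by rewrite ltr_wpDl// !addr_ge0// !mulr_ge0// ltW.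
pose t := Num.min (1 / 2) (e / K).
have t0 : 0 < t by rewrite lt_min !divr_gt0.
have t1 : t < 1 by rewrite gt_min; apply/orP; left; lra.
have tK : t * K <= e by rewrite -ler_pdivlMr// ge_min lexx orbT.
have [c cP] := rat_approx ((1 - t) *: u + t *: v0) _ (mulr_gt0 t0 (divr_gt0 r0 (ltr0Sn R 1))).
set q : 'rV[R]_n := map_mx ratr c.
(* Chosen so that [q] is exactly the convex combination of [u] and [v0 + h]; the accuracy
   [t * (r / 2)] of [q] makes [h] shorter than [r]. *)
pose h := t^-1 *: (q - ((1 - t) *: u + t *: v0)).
have hr : `|h| < r.
  apply: (@le_lt_trans _ _ (r / 2)); last by rewrite ltr_pdivrMr// ltr_pMr// ltr1n.
  rewrite normrZ gtr0_norm ?invr_gt0// mulrC ler_pdivrMr//.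
  apply: norm_le_coord => [|i]; first by rewrite mulr_ge0 ?divr_ge0// ltW.
  by have := ltW (cP i); rewrite !mxE distrC (mulrC t (r / 2)).
have qE : q = (1 - t) *: u + t *: (v0 + h).
  by rewrite scalerDr addrA /h scalerA divff ?gt_eqF// scale1r addrC subrK.
clearbody h.
have gq : (g q <= ((1 - t) * fine (g u) + t * M)%:E)%E.
  rewrite qE; apply: (le_trans (gc _ _ _ _)); first by rewrite t0 t1.
  rewrite [leRHS]EFinD; apply: leeD; first by rewrite EFinM fineK.
  by rewrite EFinM; apply: lee_wpmul2l; [rewrite lee_fin ltW|exact: gM].
apply: (@le_trans _ _ (((dotv q y)%:E - g q) + e%:E)%E); last first.
  by rewrite leeD2r//; apply: ereal_sup_ubound; exists c.
have gqf : g q \is a fin_num by rewrite fin_numElt gNy (le_lt_trans gq)// ltry.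
move: gq; rewrite -(fineK gqf) -EFinB -EFinD !lee_fin => gq.
have qy : dotv q y = dotv u y + t * (dotv (v0 - u) y + dotv h y).
  by rewrite qE (dotvDl ((1 - t) *: u)) !dotvZl (dotvDl v0 h) (dotvBl v0 u); ring.
have b1 : - `|dotv (v0 - u) y| <= dotv (v0 - u) y by rewrite lerNl ler_normr lexx orbT.
have b2 : - (n%:R * (r * `|y|)) <= dotv h y.
  rewrite lerNl (le_trans (ler_norm _))// normrN (le_trans (dotv_norm_le _ _))//.
  by rewrite ler_wpM2l// ler_wpM2r// ltW.
have b3 : M - fine (g u) <= `|M - fine (g u)| by exact: ler_norm.
have tKE : t * K = t * `|dotv (v0 - u) y| + t * (n%:R * (r * `|y|)) +
  t * `|M - fine (g u)| + t by rewrite /K; ring.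
have := ler_wpM2l (ltW t0) b1; have := ler_wpM2l (ltW t0) b2.
have := ler_wpM2l (ltW t0) b3.
rewrite qy; rewrite tKE in tK; move: gq tK.
by move=> *; lra.
Qed.

End conjugate.

Lemma node_exists {R : realType} {d} (FU : probability (Rv R d) R) : exists j0 : node FU, True.
Proof.
have [x nx] := ae_ex _ _ (ae_ratball_neq0 FU).
have [j [jx _]] := ratball_base [set: 'rV[R]_d] x openT I.
have Fj : (0 < FU (ratball j))%E.
  by rewrite lt_neqAle measure_ge0 andbT eq_sym nx.
by exists (exist _ j Fj).
Qed.

Definition is_potential_pair {R : realType} {d k} (FU : probability (Rv R d) R)
    (Q : 'rV[R]_d * 'rV[R]_k -> 'rV[R]_d) (Zs : set 'rV[R]_k)
    (phi psi : 'rV[R]_d * 'rV[R]_k -> \bar R) :=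
  [/\ measurable_fun setT (phi : Rv R d * Rv R k -> \bar R),
      measurable_fun setT (psi : Rv R d * Rv R k -> \bar R),
      (forall p, (-oo < phi p)%E /\ (-oo < psi p)%E) &
      forall z, Zs z -> [/\ (forall x, phi (x, z) = conj (fun y => psi (y, z)) x),
        (forall y, psi (y, z) = conj (fun x => phi (x, z)) y),
        econvex (fun x => phi (x, z)) /\ econvex (fun y => psi (y, z)),
        lower_semicontinuous (fun x => phi (x, z)) /\
        lower_semicontinuous (fun y => psi (y, z)) &
        {ae FU, forall u, phi (u, z) \is a fin_num /\
          subgrad (fun x => phi (x, z)) u (Q (u, z))}]].

Lemma potential_pair_exists {R : realType} {d k} (FU : probability (Rv R d) R)
    (Q : 'rV[R]_d * 'rV[R]_k -> 'rV[R]_d) (Zs : set 'rV[R]_k) :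
  measurable_fun setT (Q : Rv R d * Rv R k -> Rv R d) ->
  measurable (Zs : set (Rv R k)) ->
  (forall z, Zs z -> exists f : 'rV[R]_d -> \bar R,
    [/\ (forall u, (-oo < f u)%E), econvex f &
        {ae FU, forall u, egrad f u (Q (u, z))}]) ->
  exists phi psi, is_potential_pair FU Q Zs phi psi.
Proof.
move=> mQ mZs fQ.
have [j0 _] := node_exists FU.
pose pot := potential FU Q j0.
have potE z : (fun x => pot (x, z)) =
    esup_affine (seq (node FU)) (fun s => cslope FU Q j0 s z)
      (EFin \o (fun s => - cconst FU Q j0 s z)).
  apply/funext => x; congr ereal_sup; apply/seteqP; split => _ [s _ <-]; exists s => //=;
  by rewrite -EFinB opprK.
(* The conjugate over rational points is Borel everywhere; it is shown to be the true conjugate only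
   for [z] in [Zs]. *)
pose cst (p : 'rV[R]_d * 'rV[R]_k) : \bar R := ereal_sup [set
  ((dotv (map_mx ratr c : 'rV[R]_d) p.1)%:E - pot (map_mx ratr c, p.2))%E |
  c in [set: 'rV[rat]_d]].
pose D : set (Rv R d * Rv R k) := snd @^-1` Zs.
have mD : measurable D.
  rewrite -[D]setTI.
  exact: (@measurable_snd _ _ (Rv R d) (Rv R k) measurableT Zs mZs).
have mpot : measurable_fun setT (pot : Rv R d * Rv R k -> \bar R).
  exact: measurable_potential.
have mcst : measurable_fun setT (cst : Rv R d * Rv R k -> \bar R).
  apply: measurable_countable_esup => c; apply: emeasurable_funB.
    apply/measurable_EFinP; apply: measurable_dotv => //.
  apply: (measurableT_comp mpot); exact: measurable_fun_pair.
have potNy p : (-oo < pot p)%E by exact: potential_gtNy.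
have potc z : econvex (fun x => pot (x, z)).
  rewrite potE; apply: esup_affine_convex => [i|x]; first exact: ltNyr.
  by rewrite -potE.
have key z : Zs z -> [/\ (forall y, cst (y, z) = conj (fun x => pot (x, z)) y),
    (forall y, (-oo < cst (y, z))%E) &
    {ae FU, forall u, pot (u, z) \is a fin_num /\
      subgrad (fun x => pot (x, z)) u (Q (u, z))}].
  move=> Zz; have [f [fNy fc fg]] := fQ z Zz.
  have fs : {ae FU, forall v, f v \is a fin_num /\ subgrad f v (Q (v, z))}.
    by apply: aeS fg => v fv; split; [exact: egrad_fin_num fv|exact: egrad_subgrad].
  have [c cP] := potential_le FU Q mQ j0 z f fNy fs.
  have {}cP x : (pot (x, z) + c%:E <= f x)%E by exact: cP.
  have [v0 fv0] := ae_ex _ _ fg.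
  have fv0f := egrad_fin_num _ _ _ fv0.
  have potf x : (f x < +oo)%E -> (pot (x, z) < +oo)%E.
    move=> fx; have := le_lt_trans (cP x) fx.
    by case: (pot (x, z)) => //= *; rewrite ltry.
  have cE y : cst (y, z) = conj (fun x => pot (x, z)) y.
    have /egradP /(_ 1 ltr01)[r r0 rP] := fv0.
    (* The expansion of [f] at [v0] with error constant 1 bounds [f] on the ball of radius [r];
       subtracting [c] bounds the potential. *)
    pose M := fine (f v0) + d%:R * (`|Q (v0, z)| * r) + r - c.
    apply/esym; apply: (conj_rational (fun x => pot (x, z)) v0 M r) => //.
    move=> h hr; have [fh up] := rP h hr.
    have := cP (v0 + h); rewrite -(fineK fh) => ph.
    have pf : pot (v0 + h, z) \is a fin_num.
      rewrite fin_numElt potNy/= potf// -(fineK fh) ltry//.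
    move: ph; rewrite -(fineK pf) -EFinD !lee_fin /M.
    move: up; rewrite ler_norml mul1r => /andP[_ up].
    have b : dotv (Q (v0, z)) h <= d%:R * (`|Q (v0, z)| * r).
      rewrite (le_trans (ler_norm _))// (le_trans (dotv_norm_le _ _))//.
      by rewrite ler_wpM2l// ler_wpM2l// ltW.
    by move: hr b up; lra.
  split => //.
    move=> y; rewrite cE; apply: conj_gtNy; exists v0.
    by apply: potf; rewrite ltey_eq fv0f.
  have := aeI _ _ _ (aeI _ _ _ fg fs) (ae_ratball_neq0 FU).
  apply: aeS => u [[fu [fuf fus]] nu]; split.
    by rewrite fin_numElt potNy potf// ltey_eq fuf.
  exact: (potential_subgrad FU Q mQ j0 z f fs u fu fus).
(* Off [Zs] the conjugate might be [-oo], which dual feasibility forbids, so both functions are set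
   to 0 there. *)
exists (pot \_ D), (cst \_ D).
have phiE x z : Zs z -> (pot \_ D) (x, z) = pot (x, z).
  by move=> Zz; rewrite patchE ifT// inE.
have psiE y z : Zs z -> (cst \_ D) (y, z) = cst (y, z).
  by move=> Zz; rewrite patchE ifT// inE.
split.
- by apply/(measurable_restrictT _ mD); exact: measurable_funTS.
- by apply/(measurable_restrictT _ mD); exact: measurable_funTS.
- move=> [x z]; rewrite !patchE; case: ifPn => [|_]; last by rewrite ltNyr.
  by rewrite inE => Zz; split; [exact: potNy|have [_ + _] := key z Zz].
move=> z Zz; have [cE cNy ps] := key z Zz.
have fphi : (fun x => (pot \_ D) (x, z)) = (fun x => pot (x, z)).
  by apply/funext => x; exact: phiE.
have fpsi : (fun y => (cst \_ D) (y, z)) = conj (fun x => pot (x, z)).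
  by apply/funext => y; rewrite psiE// cE.
rewrite fphi fpsi; split.
- move=> x; rewrite phiE// -[LHS]/((fun x => pot (x, z)) x) potE.
  by apply: biconj_affine => [u|y]; rewrite -potE// -cE.
- by move=> y; rewrite psiE// cE.
- by split => //; apply: esup_affine_convex => // y; rewrite -[esup_affine _ _ _]/(conj _) -cE.
- split; first by rewrite potE; apply: esup_affine_lsc => i; exact: ltNyr.
  exact: esup_affine_lsc.
- by apply: aeS ps => u [pu pus]; rewrite phiE.
Qed.

(** * Lower-bounded integrals *)

Lemma measure_eq_rectangles {R : realType} d1 d2 (T1 : measurableType d1)
    (T2 : measurableType d2) (m1 m2 : {measure set (T1 * T2) -> \bar R}) :
  (m1 setT < +oo)%E ->
  (forall A B, measurable A -> measurable B -> m1 (A `*` B) = m2 (A `*` B)) ->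
  forall C, measurable C -> m1 C = m2 C.
Proof.
move=> fin m12 C mC.
pose G := [set C : set (T1 * T2) | exists A B, [/\ measurable A, measurable B & C = A `*` B]].
apply: (measure_unique G (fun=> setT)) => //.
- rewrite measurable_prod_measurableType; congr (<<s _ >>).
  apply/seteqP; split => [_ [A mA [B mB <-]]|_ [A [B [mA mB ->]]]].
    by exists A, B.
  by exists A => //; exists B.
- move=> _ _ [A [B [mA mB ->]]] [A' [B' [mA' mB' ->]]].
  exists (A `&` A'), (B `&` B'); rewrite setXI; split => //; exact: measurableI.
- by move=> _; exists setT, setT; rewrite setXTT; split.
- by rewrite bigcup_const.
- by move=> _ [A [B [mA mB ->]]]; exact: m12.
Qed.

(** * Symmetric truncation of real numbers *)

Section truncation.
Context {R : realType}.
Implicit Types x y : R.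

Definition clamp (n : nat) x : R := Num.max (- n%:R) (Num.min n%:R x).

Lemma clamp_le n x : `|clamp n x| <= n%:R.
Proof.
have n0 : 0 <= n%:R :> R by [].
rewrite /clamp ler_norml le_max lexx ge_max ge_min lexx/= andbT.
by rewrite (le_trans _ n0)// oppr_le0.
Qed.

Lemma clamp_id n x : `|x| <= n%:R -> clamp n x = x.
Proof. by rewrite ler_norml /clamp => /andP[? ?]; rewrite min_r// max_r. Qed.

Lemma clampE n x : [\/ clamp n x = x /\ - n%:R <= x <= n%:R,
  clamp n x = n%:R /\ n%:R <= x | clamp n x = - n%:R /\ x <= - n%:R].
Proof.
rewrite /clamp; have [nx|xn] := leP n%:R x.
  by constructor 2; split => //; rewrite max_r// (@le_trans _ _ 0)// oppr_le0.
by have [nx|/ltW nx] := leP (- n%:R) x; [constructor 1; rewrite (ltW xn)|constructor 3].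
Qed.

(** Truncation is odd, nondecreasing and 1-Lipschitz, so truncating both summands at one level moves
    their sum towards 0 without crossing it. This yields both the domination and the lower bound
    needed for Fatou. *)
Lemma clampD_bounds n x y : - Num.max 0 (- (x + y)) <= clamp n x + clamp n y <= Num.max 0 (x + y).
Proof.
have [/(_ x) cx /(_ y) cy] := (clampE n, clampE n).
have n0 : 0 <= n%:R :> R by [].
have [m0 mN] : 0 <= Num.max 0 (- (x + y)) /\ - (x + y) <= Num.max 0 (- (x + y)).
  by rewrite !le_max !lexx orbT.
have [m0' mN'] : 0 <= Num.max 0 (x + y) /\ x + y <= Num.max 0 (x + y).
  by rewrite !le_max !lexx orbT.
by case: cx => -[-> ?]; case: cy => -[-> ?]; apply/andP; split; lra.
Qed.

Lemma clampD_norm n x y : `|clamp n x + clamp n y| <= `|x + y|.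
Proof.
have /andP[l u] := clampD_bounds n x y; rewrite ler_norml; apply/andP; split.
  by apply: le_trans l; rewrite lerN2 ge_max normr_ge0 -normrN ler_norm.
by apply: (le_trans u); rewrite ge_max normr_ge0 ler_norm.
Qed.

Lemma measurable_clamp n : measurable_fun setT (clamp n).
Proof. by apply: measurable_maxr => //; exact: measurable_minr. Qed.

Lemma cvg_clamp x : (clamp n x)%:E @[n --> \oo] --> x%:E.
Proof.
apply: cvg_near_cst; exists (Num.truncn `|x|).+1 => // n /= xn.
congr EFin; apply: clamp_id; by rewrite (le_trans (ltW (truncnS_gt _)))// ler_nat.
Qed.

End truncation.

Lemma cvg_limn_einfE {R : realType} (u : (\bar R)^nat) (l : \bar R) :
  u n @[n --> \oo] --> l -> limn_einf u = l.
Proof.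
by move=> ul; rewrite limn_einf_lim; apply/cvg_lim => //; exact: cvg_einfs.
Qed.

Section lower_bounded_integral.
Context {R : realType} {d} {T : measurableType d} (mu : {measure set T -> \bar R}).
Variables F g : T -> \bar R.
Hypotheses (mF : measurable_fun setT F) (ig : mu.-integrable setT g)
  (gF : {ae mu, forall t, (g t <= F t)%E}).

Lemma integrable_funeneg_lower : mu.-integrable setT F^\-%E.
Proof.
have mg := measurable_int _ ig.
apply/integrableP; split; first exact: measurable_funeneg.
have /integrableP[_] := integrable_funeneg measurableT ig.
apply: le_lt_trans; apply: ae_ge0_le_integral => //.
- by apply: measurableT_comp => //; exact: measurable_funeneg.
- by apply: measurableT_comp => //; exact: measurable_funeneg.
- apply: aeS gF => t gFt _; rewrite !gee0_abs ?funeneg_ge0// !funenegE.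
  by rewrite ge_max; apply/andP; split; rewrite le_max ?leeN2 ?gFt ?lexx ?orbT.
Qed.

Lemma integrable_lower : (\int[mu]_t F t != +oo)%E -> mu.-integrable setT F.
Proof.
move=> Fy; have iFn := integrable_funeneg_lower.
apply/integrableP; split => //.
rewrite (eq_integral (fun t => F^\+ t + F^\- t)%E); last first.
  by move=> t _; rewrite -[LHS]/((abse \o F) t) fune_abse.
rewrite ge0_integralD//; [|exact: measurable_funepos|exact: measurable_funeneg].
have Fn : (\int[mu]_t F^\- t)%E \is a fin_num by exact: (integrable_fin_num measurableT iFn).
rewrite lte_add_pinfty//; last by rewrite ltey_eq Fn.
rewrite ltey; apply/eqP => Fp; move/eqP: Fy; rewrite integralE Fp; apply.
by rewrite addye// eqe_oppLR /=; move: Fn; case: integral.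
Qed.

Lemma le_integral_lower : (\int[mu]_t g t <= \int[mu]_t F t)%E.
Proof.
have mg := measurable_int _ ig.
rewrite integralE [leRHS]integralE leeB//.
- apply: ae_ge0_le_integral => //; [exact: measurable_funepos|exact: measurable_funepos|].
  apply: aeS gF => t gFt _; rewrite !funeposE.
  by rewrite ge_max; apply/andP; split; rewrite le_max ?gFt ?lexx ?orbT.
- apply: ae_ge0_le_integral => //; [exact: measurable_funeneg|exact: measurable_funeneg|].
  apply: aeS gF => t gFt _; rewrite !funenegE.
  by rewrite ge_max; apply/andP; split; rewrite le_max ?leeN2 ?gFt ?lexx ?orbT.
Qed.

(** The equality case of [le_integral_lower], from which uniqueness of the primal solution is
    drawn. *)
Lemma ae_eq_lower : (\int[mu]_t F t <= \int[mu]_t g t)%E -> {ae mu, forall t, F t = g t}.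
Proof.
move=> Fg; have gfin := integrable_fin_num measurableT ig.
have mg := measurable_int _ ig.
have iF : mu.-integrable setT F.
  by apply: integrable_lower; rewrite -ltey (le_lt_trans Fg)// ltey_eq gfin.
have Ffin := integrable_fin_num measurableT iF.
have mFg : measurable_fun setT (fun t => F t - g t)%E by exact: emeasurable_funB.
have : (\int[mu]_t `|F t - g t| = 0)%E.
  rewrite (ae_eq_integral (fun t => F t - g t)%E)//.
  - rewrite integralB//; apply/eqP; rewrite sube_eq// ?fin_num_adde_defr//.
    by rewrite add0e eq_le Fg le_integral_lower.
  - exact: measurableT_comp.
  - have := aeI _ _ _ gF (aeI _ _ _ (integrable_ae measurableT ig) (integrable_ae measurableT iF)).
    apply: aeS => t [gFt [gt Ft]] _; rewrite gee0_abs// sube_ge0// ?gt ?Ft//.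
move=> /(ae_eq_integral_abs mu measurableT mFg) => H.
have := aeI _ _ _ H (aeI _ _ _ (integrable_ae measurableT ig) (integrable_ae measurableT iF)).
apply: aeS => t [/(_ Logic.I) /= Fgt [/(_ Logic.I) gt /(_ Logic.I) Ft]].
move: Fgt; rewrite -(fineK gt) -(fineK Ft) -EFinB => -[] /eqP.
by rewrite subr_eq0 => /eqP ->.
Qed.

End lower_bounded_integral.
Arguments integrable_funeneg_lower {R d T mu F g}.
Arguments integrable_lower {R d T mu F g}.
Arguments le_integral_lower {R d T mu F g}.
Arguments ae_eq_lower {R d T mu F g}.

(* The expectation of a sum depends only on the laws of the two summands, even when
   they are not separately integrable (Simons, An unexpected expectation, 1977). *)
Lemma expectation_sum_le {R : realType} dO dS (Om : measurableType dO)
    (S : measurableType dS) (P : probability Om R) (A A' : Om -> S)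
    (phi : S -> \bar R) (W : Om -> \bar R) (g g' : Om -> \bar R) :
  measurable_fun setT A -> measurable_fun setT A' ->
  (forall C, measurable C -> P (A @^-1` C) = P (A' @^-1` C)) ->
  measurable_fun setT phi -> measurable_fun setT W ->
  (forall s, (-oo < phi s)%E) -> (forall w, (-oo < W w)%E) ->
  P.-integrable setT g -> P.-integrable setT g' ->
  {ae P, forall w, (g w <= phi (A w) + W w)%E} ->
  {ae P, forall w, (g' w <= phi (A' w) + W w)%E} ->
  (\int[P]_w (phi (A' w) + W w) <= \int[P]_w (phi (A w) + W w))%E.
Proof.
move=> mA mA' law mphi mW phiNy WNy ig ig' gF gF'.
have mphiA : measurable_fun setT (phi \o A) by exact: measurableT_comp.
have mphiA' : measurable_fun setT (phi \o A') by exact: measurableT_comp.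
set F := fun w => (phi (A w) + W w)%E.
set F' := fun w => (phi (A' w) + W w)%E.
have mF : measurable_fun setT F by exact: emeasurable_funD.
have mF' : measurable_fun setT F' by exact: emeasurable_funD.
have [Fy|Fy] := eqVneq (\int[P]_w F w)%E +oo%E; first by rewrite Fy leey.
have iF'n := integrable_funeneg_lower mF' ig' gF'.
have iF := integrable_lower mF ig gF Fy.
have finA : {ae P, forall w, phi (A w) \is a fin_num /\ W w \is a fin_num}.
  have := integrable_ae measurableT iF; apply: aeS => w /(_ I).
  by rewrite /F fin_numD => /andP[].
(* Finiteness of [phi] is a property of the law, which [A] and [A'] share. *)
have finA' : {ae P, forall w, phi (A' w) \is a fin_num}.
  pose C := phi @^-1` [set +oo%E].
  have mC : measurable C by rewrite -[C]setTI; apply: mphi => //; exact: emeasurable_set1.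
  have PC : P (A' @^-1` C) = 0%E.
    rewrite -law//; apply: measure_negligible.
      by rewrite -[X in measurable X]setTI; exact: mA.
    by apply: negligibleS finA => w /= Cw [+ _]; rewrite Cw.
  exists (A' @^-1` C); split => //.
    by rewrite -[X in measurable X]setTI; exact: mA'.
  by move=> w /= /negP; rewrite fin_numE negb_and !negbK gt_eqF//= => /eqP.
pose X w := fine (phi (A w)); pose X' w := fine (phi (A' w)); pose v w := fine (W w).
have mfine : measurable_fun setT (@fine R) by exact: fine_measurable.
have mX : measurable_fun setT X by exact: (measurableT_comp mfine mphiA).
have mX' : measurable_fun setT X' by exact: (measurableT_comp mfine mphiA').
have mv : measurable_fun setT v by exact: (measurableT_comp mfine mW).
have mXv : measurable_fun setT (fun w => (X w + v w)%:E).
  by apply/measurable_EFinP; exact: measurable_funD.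
have mX'v : measurable_fun setT (fun w => (X' w + v w)%:E).
  by apply/measurable_EFinP; exact: measurable_funD.
have FE : {ae P, forall w, setT w -> F w = (X w + v w)%:E}.
  by apply: aeS finA => w [pw Ww] _; rewrite /F /X /v EFinD !fineK.
have FE' : {ae P, forall w, setT w -> F' w = (X' w + v w)%:E}.
  by apply: aeS (aeI _ _ _ finA finA') => w [[_ Ww] pw] _; rewrite /F' /X' /v EFinD !fineK.
have IE : (\int[P]_w F w = \int[P]_w (X w + v w)%:E)%E by exact: ae_eq_integral.
have IE' : (\int[P]_w F' w = \int[P]_w (X' w + v w)%:E)%E by exact: ae_eq_integral.
rewrite IE IE'.
have bint (h : Om -> R) (C : R) : measurable_fun setT h -> (forall w, `|h w| <= C) ->
    P.-integrable setT (EFin \o h).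
  move=> mh hC; apply: measurable_bounded_integrable => //.
    by rewrite (le_lt_trans (probability_le1 P measurableT))// ltry.
  exists C; split; first exact: num_real.
  by move=> x Cx w _ /=; exact: le_trans (hC w) (ltW Cx).
have mcl n (h : Om -> R) : measurable_fun setT h -> measurable_fun setT (clamp n \o h).
  by move=> mh; exact: measurableT_comp (measurable_clamp n) mh.
have icl n (h : Om -> R) : measurable_fun setT h -> P.-integrable setT (EFin \o (clamp n \o h)).
  by move=> mh; apply: (bint _ n%:R); [exact: mcl|move=> w; exact: clamp_le].
have eqI n : (\int[P]_w (clamp n (X w))%:E = \int[P]_w (clamp n (X' w))%:E)%E.
  pose h s := (clamp n (fine (phi s)))%:E.
  have mh : measurable_fun setT h.
    apply/measurable_EFinP; apply: measurableT_comp; first exact: measurable_clamp.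
    exact: measurableT_comp.
  rewrite -[LHS]/(\int[P]_(w in A @^-1` setT) (h \o A) w)%E.
  rewrite -[RHS]/(\int[P]_(w in A' @^-1` setT) (h \o A') w)%E.
  rewrite -(integral_pushforward mA mh)//; last exact: icl.
  rewrite -(integral_pushforward mA' mh)//; last exact: icl.
  by apply: (@eq_measure_integral _ _ _ _ (pushm P mA') (pushm P mA)) => C mC _; exact: law.
(* Once truncated, the summands are integrable and the expectation splits, so [X] and [X'] give the
   same sequence. *)
pose I n := (\int[P]_w (clamp n (X w) + clamp n (v w))%:E)%E.
have I' n : I n = (\int[P]_w (clamp n (X' w) + clamp n (v w))%:E)%E.
  rewrite /I; under eq_integral do rewrite EFinD.
  under [RHS]eq_integral do rewrite EFinD.
  by rewrite integralD//; [rewrite eqI -integralD//|..]; exact: icl.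
have iXv : P.-integrable setT (fun w => (X w + v w)%:E).
  apply/integrableP; split => //; have /integrableP[_] := iF.
  suff -> : (\int[P]_w `|F w| = \int[P]_w `|(X w + v w)%:E|)%E by [].
  apply: ae_eq_integral => //; [exact: measurableT_comp|exact: measurableT_comp|].
  by apply: aeS FE => w + _ => /(_ Logic.I) ->.
have cvI : I n @[n --> \oo] --> (\int[P]_w (X w + v w)%:E)%E.
  apply: (@dominated_cvg _ _ _ P setT measurableT _ _ (fun w => `|X w + v w|%:E)).
  - by move=> n; apply/measurable_EFinP; apply: measurable_funD; exact: mcl.
  - by move=> w _; under eq_fun do rewrite EFinD; rewrite EFinD;
      apply: cvgeD => //; exact: cvg_clamp.
  - by [].
  - exact: integrable_abse iXv.
  - by move=> n w _; rewrite lee_fin clampD_norm.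
pose N w := Num.max 0 (- (X' w + v w)).
have mN : measurable_fun setT N.
  by apply: measurable_maxr => //; apply: measurableT_comp => //; exact: measurable_funD.
have iN : P.-integrable setT (EFin \o N).
  apply/integrableP; split; first exact/measurable_EFinP.
  have /integrableP[_] := iF'n.
  suff -> : (\int[P]_w `|F'^\- w| = \int[P]_w `|(N w)%:E|)%E by [].
  apply: ae_eq_integral => //.
  - by apply: measurableT_comp => //; exact: measurable_funeneg.
  - by apply: measurableT_comp => //; exact/measurable_EFinP.
  - apply: aeS FE' => w + _ => /(_ Logic.I) FEw; rewrite funenegE FEw -EFinN.
    by rewrite -EFin_max maxC.
have NR w : X' w + v w = Num.max 0 (X' w + v w) - N w.
  by rewrite /N; case: (leP 0 (X' w + v w)) => ?; case: (leP 0 (- (X' w + v w))) => ?; lra.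
have NE : ((fun w => (X' w + v w)%:E) = (fun w => (Num.max 0 (X' w + v w))%:E - (N w)%:E))%E.
  by apply/funext => w; rewrite -EFinB -NR.
have fat : (\int[P]_w (Num.max 0 (X' w + v w))%:E <=
    \int[P]_w (X w + v w)%:E + \int[P]_w (N w)%:E)%E.
  pose h n w := (clamp n (X' w) + clamp n (v w) + N w)%:E.
  have mh n : measurable_fun setT (h n).
    by apply/measurable_EFinP; apply: measurable_funD => //; apply: measurable_funD; exact: mcl.
  have h0 n w : setT w -> (0 <= h n w)%E.
    move=> _; rewrite lee_fin -lerBlDr sub0r.
    by have /andP[] := clampD_bounds n (X' w) (v w).
  have hE n : (\int[P]_w h n w = I n + \int[P]_w (N w)%:E)%E.
    rewrite /h I'; under eq_integral do rewrite EFinD.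
    rewrite integralD//; apply: (bint _ (n%:R + n%:R)).
      by apply: measurable_funD; exact: mcl.
    by move=> w; rewrite (le_trans (ler_normD _ _))// lerD// clamp_le.
  have cvh : (\int[P]_w h n w)%E @[n --> \oo] -->
      (\int[P]_w (X w + v w)%:E + \int[P]_w (N w)%:E)%E.
    under eq_fun do rewrite hE.
    apply: cvgeD => //; last exact: cvg_cst.
    by rewrite fin_num_adde_defl// integrable_fin_num.
  have := fatou P measurableT mh h0.
  rewrite (cvg_limn_einfE _ _ cvh); apply: le_trans.
  suff -> : (\int[P]_w (Num.max 0 (X' w + v w))%:E = \int[P]_w limn_einf (h^~ w))%E by [].
  apply: eq_integral => w _.
  rewrite (@cvg_limn_einfE _ _ (X' w + v w + N w)%:E); last first.
    rewrite /h; under eq_fun do rewrite !EFinD; rewrite !EFinD.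
    apply: cvgeD => //; last exact: cvg_cst.
    by apply: cvgeD => //; exact: cvg_clamp.
  by rewrite [in RHS](NR w) subrK.
rewrite NE integralB//.
- by rewrite leeBlDr// integrable_fin_num.
- apply/integrableP; split.
    by apply/measurable_EFinP; apply: measurable_maxr => //; exact: measurable_funD.
  under eq_integral => w _ do rewrite gee0_abs ?lee_fin ?le_max ?lexx//.
  apply: (le_lt_trans fat); rewrite lte_add_pinfty//.
    by rewrite -IE ltey.
  by rewrite ltey_eq integrable_fin_num.
Qed.

(** * Conditional laws *)

Section disintegration.
Context {R : realType} {dO} {Om : measurableType dO} (P : probability Om R) {d k : nat}.
Variables (Y : Om -> Rv R d) (Z : Om -> Rv R k) (FYZ : 'rV[R]_k -> probability (Rv R d) R).
Hypotheses (mY : measurable_fun setT Y) (mZ : measurable_fun setT Z)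
  (mF : forall A, measurable A -> measurable_fun setT (fun z : Rv R k => FYZ z A))
  (hF : cond_law P Y Z (fun z => FYZ z)).

Let K (z : Rv R k) : {measure set (Rv R d) -> \bar R} := FYZ z.
HB.instance Definition _ := isKernel.Build _ _ _ _ _ K mF.
HB.instance Definition _ := Kernel_isProbability.Build _ _ _ _ _ K
  (fun z => probability_setT (FYZ z)).

(** The joint law of [(Z, Y)] rebuilt from the kernel. [Z] comes first so that the sections to be
    measured are those of [xsection]. *)
Let dis (C : set (Rv R k * Rv R d)) : \bar R :=
  (\int[P]_w FYZ (Z w) (xsection C (Z w)))%E.

Let measurable_dis C : measurable C ->
  measurable_fun setT (fun w => FYZ (Z w) (xsection C (Z w))).
Proof.
move=> mC.
have mk := measurable_fun_xsection_finite_kernel (K : R.-fker _ ~> _) (mem_set mC).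
exact: (measurableT_comp mk mZ).
Qed.

Let dis0 : dis set0 = 0%E.
Proof. by rewrite /dis; under eq_integral do rewrite xsection0 measure0; rewrite integral0. Qed.

Let dis_ge0 C : (0 <= dis C)%E.
Proof. by apply: integral_ge0 => w _. Qed.

Let dis_sigma_additive : semi_sigma_additive dis.
Proof.
move=> F mC tF mUF.
rewrite [X in _ --> X](_ : _ = (\sum_(n <oo) dis (F n))%E).
  by apply/cvg_closeP; split; [exact: is_cvg_nneseries|rewrite closeE].
rewrite /dis -integral_nneseries//; last by move=> n; exact: measurable_dis.
apply: eq_integral => w _; apply/esym/cvg_lim => //=; rewrite xsection_bigcup.
apply: (measure_sigma_additive _ (trivIset_xsection tF)) => ?.
exact: measurable_xsection.
Qed.

HB.instance Definition _ := isMeasure.Build _ _ _ dis dis0 dis_ge0 dis_sigma_additive.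

(** [cond_law] is this identity on rectangles; two measures agreeing there, with finite total mass,
    agree on all Borel sets. *)
Lemma disintegration (C : set (Rv R d * Rv R k)) : measurable C ->
  P [set w | C (Y w, Z w)] = (\int[P]_w FYZ (Z w) [set y | C (y, Z w)])%E.
Proof.
move=> mC.
have mZY : measurable_fun setT (fun w => (Z w, Y w)) by exact: measurable_fun_pair.
pose C' := [set p : Rv R k * Rv R d | C (p.2, p.1)].
have mC' : measurable C'.
  have ms : measurable_fun setT (fun p : Rv R k * Rv R d => (p.2, p.1)).
    exact: measurable_fun_pair.
  by rewrite -[C']setTI; exact: ms.
rewrite -[LHS]/(pushm P mZY C').
rewrite (@measure_eq_rectangles _ _ _ _ _ (pushm P mZY) dis)//.
- apply: eq_integral => w _; congr (FYZ _ _).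
  by apply/seteqP; split => y; rewrite /xsection/= inE.
- by rewrite pushmE preimage_setT (le_lt_trans (probability_le1 P measurableT))// ltry.
move=> B A mB mA; rewrite pushmE/= /dis.
transitivity (P (Y @^-1` A `&` Z @^-1` B)).
  by congr (P _); apply/seteqP; split => w /= [].
rewrite hF// integral_mkcond; apply: eq_integral => w _; rewrite patchE.
have -> : (w \in Z @^-1` B) = (Z w \in B) by apply/idP/idP; rewrite !inE.
by case: ifPn => Bw; [rewrite in_xsectionX|rewrite notin_xsectionX// measure0].
Qed.

Lemma measurable_disintegration (C : set (Rv R d * Rv R k)) : measurable C ->
  measurable_fun setT (fun w => FYZ (Z w) [set y | C (y, Z w)]).
Proof.
move=> mC.
pose C' := [set p : Rv R k * Rv R d | C (p.2, p.1)].
have mC' : measurable C'.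
  have ms : measurable_fun setT (fun p : Rv R k * Rv R d => (p.2, p.1)).
    exact: measurable_fun_pair.
  by rewrite -[C']setTI; exact: ms.
have := measurable_dis C' mC'; rewrite (_ : (fun _ => _) = fun w => FYZ (Z w) [set y | C (y, Z w)])//.
apply/funext => w; congr (FYZ _ _).
by apply/seteqP; split => y; rewrite /xsection/= inE.
Qed.

End disintegration.

(** * Random vectors with conditional law [FU] given [Z] *)

Section feasible.
Context {R : realType} {dO} {Om : measurableType dO} (P : probability Om R) {d k : nat}.
Variables (Z : Om -> Rv R k) (FU : probability (Rv R d) R).
Hypothesis mZ : measurable_fun setT Z.

Lemma feasible_rect V A B : primal_feasible P Z FU V -> measurable A -> measurable B ->
  P (V @^-1` A `&` Z @^-1` B) = (FU A * P (Z @^-1` B))%E.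
Proof.
move=> [mV hV] mA mB; rewrite hV// integral_cst//.
by rewrite -[X in measurable X]setTI; exact: mZ.
Qed.

Lemma feasible_law V A : primal_feasible P Z FU V -> measurable A -> P (V @^-1` A) = FU A.
Proof.
move=> fV mA; have := feasible_rect V A setT fV mA measurableT.
by rewrite preimage_setT setIT [P setT]probability_setT mule1.
Qed.

Lemma feasible_joint_law V V' (C : set (Rv R d * Rv R k)) :
  primal_feasible P Z FU V -> primal_feasible P Z FU V' -> measurable C ->
  P ((fun w => (V w, Z w)) @^-1` C) = P ((fun w => (V' w, Z w)) @^-1` C).
Proof.
move=> fV fV' mC.
have mVZ : measurable_fun setT (fun w => (V w, Z w)).
  by apply: measurable_fun_pair => //; case: fV.
have mVZ' : measurable_fun setT (fun w => (V' w, Z w)).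
  by apply: measurable_fun_pair => //; case: fV'.
rewrite -[LHS](pushmE _ _ _ _ _ P _ mVZ) -[RHS](pushmE _ _ _ _ _ P _ mVZ').
apply: measure_eq_rectangles => //.
  by rewrite pushmE preimage_setT (le_lt_trans (probability_le1 P measurableT))// ltry.
move=> A B mA mB; rewrite !pushmE.
transitivity (P (V @^-1` A `&` Z @^-1` B)); first by [].
transitivity (P (V' @^-1` A `&` Z @^-1` B)); last by [].
by rewrite !feasible_rect.
Qed.

Lemma feasible_dot_integrable (Y V : Om -> Rv R d) : measurable_fun setT Y ->
  (\int[P]_w (sqnorm (Y w : 'rV[R]_d))%:E < +oo)%E ->
  (\int[FU]_u (sqnorm (u : 'rV[R]_d))%:E < +oo)%E ->
  primal_feasible P Z FU V ->
  P.-integrable setT (fun w => (dotv (V w : 'rV[R]_d) (Y w))%:E).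
Proof.
move=> mY Y2 U2 fV; have mV := fV.1.
have sq0 (x : 'rV[R]_d) : 0 <= sqnorm x by apply: sumr_ge0 => i _; exact: sqr_ge0.
have V2 : (\int[P]_w (sqnorm (V w : 'rV[R]_d))%:E < +oo)%E.
  have msq : measurable_fun setT (fun u : Rv R d => (sqnorm (u : 'rV[R]_d))%:E).
    by apply/measurable_EFinP; exact: measurable_sqnorm.
  have := @ge0_integral_pushforward _ _ _ _ _ V mV P setT _ measurableT msq.
  rewrite preimage_setT => <-; last by move=> u _; rewrite lee_fin.
  rewrite (@eq_measure_integral _ _ _ _ FU (pushm P mV))// => A mA _.
  by rewrite pushmE; exact: feasible_law.
apply/integrableP; split; first by apply/measurable_EFinP; exact: measurable_dotv.
apply: (@le_lt_trans _ _ (\int[P]_w ((sqnorm (V w : 'rV[R]_d))%:E + (sqnorm (Y w : 'rV[R]_d))%:E))%E).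
  apply: ge0_le_integral => //.
  - by apply: measurableT_comp => //; apply/measurable_EFinP; exact: measurable_dotv.
  - by apply: emeasurable_funD; apply/measurable_EFinP; exact: measurable_sqnorm.
  - by move=> w _; rewrite -EFinD lee_fin dotv_sqnorm_le.
rewrite ge0_integralD//.
- exact: lte_add_pinfty.
- by move=> w _; rewrite lee_fin.
- by apply/measurable_EFinP; exact: measurable_sqnorm.
- by move=> w _; rewrite lee_fin.
- by apply/measurable_EFinP; exact: measurable_sqnorm.
Qed.

End feasible.

(** * Kantorovich duality *)

Lemma ae_countable {d} {T : measurableType d} {R : realType} (I : countType)
    (mu : {measure set T -> \bar R}) (A : I -> T -> Prop) :
  (forall i, {ae mu, forall t, A i t}) -> {ae mu, forall t, forall i, A i t}.
Proof.
move=> muA.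
have [N [mN N0 sN]] := @negligible_countable_bigcup R _ _ I mu (fun i => ~` A i) muA.
by exists N; split => // t /= /existsNP[i nA]; apply: sN; exists i.
Qed.

Lemma ae_measure_eq {d} {T : measurableType d} {R : realType}
    (mu : {measure set T -> \bar R}) (A B : set T) :
  measurable A -> measurable B -> {ae mu, forall t, A t <-> B t} -> mu A = mu B.
Proof.
move=> mA mB AB; rewrite -[A]setIT -[B]setIT -!integral_indic//.
apply: ae_eq_integral => //; try by apply/measurable_EFinP; exact: measurable_indic.
apply: aeS AB => t AB _; rewrite !indicE; congr (_%:R%:E).
by congr nat_of_bool; apply/idP/idP; rewrite !inE => /AB.
Qed.

Section kantorovich.
Context {R : realType} {dO} {Om : measurableType dO} (P : probability Om R) {d k : nat}.
Variables (Y : Om -> Rv R d) (Z : Om -> Rv R k) (FU : probability (Rv R d) R)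
  (FYZ : 'rV[R]_k -> probability (Rv R d) R) (lam : {measure set (Rv R d) -> \bar R})
  (Q Qinv : 'rV[R]_d * 'rV[R]_k -> 'rV[R]_d) (Zs : set 'rV[R]_k)
  (phi psi : 'rV[R]_d * 'rV[R]_k -> \bar R).
Hypotheses (mY : measurable_fun setT Y) (mZ : measurable_fun setT Z)
  (mF : forall A, measurable A -> measurable_fun setT (fun z : Rv R k => FYZ z A))
  (hF : cond_law P Y Z (fun z => FYZ z)) (lamE : is_lebesgue_Rn lam)
  (dU : has_density lam FU) (dF : forall z, Zs z -> has_density lam (FYZ z))
  (Y2 : (\int[P]_w (sqnorm (Y w : 'rV[R]_d))%:E < +oo)%E)
  (U2 : (\int[FU]_u (sqnorm (u : 'rV[R]_d))%:E < +oo)%E)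
  (mQ : measurable_fun setT (Q : Rv R d * Rv R k -> Rv R d))
  (mQinv : measurable_fun setT (Qinv : Rv R d * Rv R k -> Rv R d))
  (pushQ : forall z, Zs z -> forall A : set (Rv R d), measurable A ->
    FU ((fun u => Q (u, z)) @^-1` A) = FYZ z A)
  (QK : forall z, Zs z -> {ae FU, forall u, Qinv (Q (u, z), z) = u})
  (ZsZ : {ae P, forall w, Zs (Z w)})
  (pair : is_potential_pair FU Q Zs phi psi).

Let mphi : measurable_fun setT (phi : Rv R d * Rv R k -> \bar R).
Proof. by case: pair. Qed.
Let mpsi : measurable_fun setT (psi : Rv R d * Rv R k -> \bar R).
Proof. by case: pair. Qed.
Let phiNy p : (-oo < phi p)%E.
Proof. by case: pair => _ _ /(_ p)[]. Qed.
Let psiNy p : (-oo < psi p)%E.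
Proof. by case: pair => _ _ /(_ p)[]. Qed.
Let phiE z : Zs z -> (fun x => phi (x, z)) = conj (fun y => psi (y, z)).
Proof. by case: pair => _ _ _ /(_ z) + Zz => /(_ Zz)[+ _ _ _ _] => ?; exact/funext. Qed.
Let psiE z : Zs z -> (fun y => psi (y, z)) = conj (fun x => phi (x, z)).
Proof. by case: pair => _ _ _ /(_ z) + Zz => /(_ Zz)[_ + _ _ _] => ?; exact/funext. Qed.

Lemma kink_null z (mu : set (Rv R d) -> \bar R) (g : Rv R d * Rv R k -> \bar R) i q :
  has_density lam mu -> measurable_fun setT g -> (forall p, (-oo < g p)%E) ->
  econvex (fun x => g (x, z)) ->
  mu [set x | kink (fun y => g (y, z)) i q x] = 0%E.
Proof.
move=> dmu mg gNy gc.
have mk : measurable ([set x | kink (fun y => g (y, z)) i q x] : set (Rv R d)).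
  have ms : measurable_fun setT (fun x : Rv R d => (x, z : Rv R k)).
    exact: measurable_fun_pair.
  by have := ms measurableT _ (measurable_kink g i q mg); rewrite setTI.
apply: (density_null _ _ _ dmu mk).
apply: (null_of_null_lines lam lamE _ (delta_mx 0 i) mk) => x.
exact: kink_line_null.
Qed.

(** Fenchel's equality at [(Qinv p, p.1)] and absence of kinks on both sides, stated by countably
    many conditions so that the set is visibly Borel. *)
Definition smooth : set (Rv R d * Rv R k) := [set p |
  [/\ (phi (Qinv p, p.2) < +oo)%E,
      (phi (Qinv p, p.2) + psi p)%E = (dotv (Qinv p) p.1)%:E,
      forall iq : 'I_d * rat, ~ kink (fun y => psi (y, p.2)) iq.1 iq.2 p.1 &
      forall iq : 'I_d * rat, ~ kink (fun x => phi (x, p.2)) iq.1 iq.2 (Qinv p)]].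

Lemma measurable_smooth : measurable smooth.
Proof.
have mq : measurable_fun setT (fun p : Rv R d * Rv R k => (Qinv p : Rv R d, p.2)).
  exact: measurable_fun_pair.
have mphiq : measurable_fun setT (fun p : Rv R d * Rv R k => phi (Qinv p, p.2)).
  exact: (measurableT_comp mphi mq).
rewrite (_ : smooth = [set p | (phi (Qinv p, p.2) < +oo)%E] `&`
  [set p | (phi (Qinv p, p.2) + psi p)%E = (dotv (Qinv p) p.1)%:E] `&`
  (\bigcap_(iq in [set: 'I_d * rat]) ~` [set p : Rv R d * Rv R k | kink (fun y => psi (y, p.2)) iq.1 iq.2 p.1]) `&`
  (\bigcap_(iq in [set: 'I_d * rat]) ~` ((fun p : Rv R d * Rv R k => (Qinv p : Rv R d, p.2)) @^-1`
     [set p : Rv R d * Rv R k | kink (fun x => phi (x, p.2)) iq.1 iq.2 p.1]))); last first.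
  apply/seteqP; split => p.
    by move=> [a b c e]; split; [split; [split|]|] => // iq _; [exact: c|exact: e].
  by move=> [[[a b] c] e]; split => // iq; [exact: (c iq I)|exact: (e iq I)].
apply: measurableI; first apply: measurableI; first apply: measurableI.
- exact: measurable_ltE.
- apply: measurable_eqE; first exact: emeasurable_funD.
  by apply/measurable_EFinP; exact: measurable_dotv.
- by apply: countable_bigcap_measurable => iq _; apply: measurableC; exact: measurable_kink.
- apply: countable_bigcap_measurable => iq _; apply: measurableC.
  by rewrite -[X in measurable X]setTI; apply: mq => //; exact: measurable_kink.
Qed.

Lemma measurable_smooth_section z : measurable ([set y | smooth (y, z)] : set (Rv R d)).
Proof.
have ms : measurable_fun setT (fun x : Rv R d => (x, z : Rv R k)).
  exact: measurable_fun_pair.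
by have := ms measurableT _ measurable_smooth; rewrite setTI.
Qed.

(** Fenchel's equality is symmetric in the two conjugate functions, so it gives a subgradient of
    each; without kinks these are gradients. *)
Lemma smooth_egrad z y : Zs z -> smooth (y, z) ->
  egrad (fun y' => psi (y', z)) y (Qinv (y, z)) /\
  egrad (fun x => phi (x, z)) (Qinv (y, z)) y.
Proof.
move=> Zz [/= phioo fen npsi nphi]; set u := Qinv (y, z) in phioo fen nphi *.
have [_ _ _ /(_ z Zz)[_ _ [cphi cpsi] _ _]] := pair.
have phif : phi (u, z) \is a fin_num by rewrite fin_numElt phiNy phioo.
have psif : psi (y, z) \is a fin_num.
  by move: fen; rewrite -(fineK phif) fin_numE; case: (psi (y, z)) (psiNy (y, z)).
split.
- apply: subgrad_kinkN_egrad => //; first by rewrite ltey_eq psif.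
    rewrite psiE//; apply: (fenchel_subgrad (fun x => phi (x, z))) => //.
    by rewrite -psiE.
  by move=> i q; exact: (npsi (i, q)).
- apply: subgrad_kinkN_egrad => //.
    rewrite phiE//; apply: (fenchel_subgrad (fun x => psi (x, z))) => //.
    by rewrite -phiE// addeC fen dotvC.
  by move=> i q; exact: (nphi (i, q)).
Qed.

Lemma ae_smooth_FU z : Zs z ->
  {ae FU, forall u, smooth (Q (u, z), z) /\ Qinv (Q (u, z), z) = u}.
Proof.
move=> Zz; have [_ _ _ /(_ z Zz)[_ _ [cphi cpsi] _ sub]] := pair.
have mQz : measurable_fun setT (fun u : Rv R d => Q (u, z) : Rv R d).
  by apply: (measurableT_comp mQ); exact: measurable_fun_pair.
have kphi : {ae FU, forall u, forall iq : 'I_d * rat, ~ kink (fun x => phi (x, z)) iq.1 iq.2 u}.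
  apply: ae_countable => iq; exists [set u | kink (fun x => phi (x, z)) iq.1 iq.2 u].
  split; last by move=> u /= /contrapT.
    have ms : measurable_fun setT (fun x : Rv R d => (x, z : Rv R k)).
      exact: measurable_fun_pair.
    by have := ms measurableT _ (measurable_kink phi iq.1 iq.2 mphi); rewrite setTI.
  exact: kink_null.
have kpsi : {ae FU, forall u, forall iq : 'I_d * rat, ~ kink (fun y => psi (y, z)) iq.1 iq.2 (Q (u, z))}.
  apply: ae_countable => iq.
  have mk : measurable ([set y | kink (fun y => psi (y, z)) iq.1 iq.2 y] : set (Rv R d)).
    have ms : measurable_fun setT (fun x : Rv R d => (x, z : Rv R k)).
      exact: measurable_fun_pair.
    by have := ms measurableT _ (measurable_kink psi iq.1 iq.2 mpsi); rewrite setTI.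
  exists ((fun u => Q (u, z)) @^-1` [set y | kink (fun y => psi (y, z)) iq.1 iq.2 y]).
  split; last by move=> u /= /contrapT.
    by rewrite -[X in measurable X]setTI; exact: mQz.
  (* The [FU]-mass of this preimage is the [FYZ z]-mass of the kinks of [psi], null because [FYZ z]
     has a density. *)
  by apply: (etrans (pushQ z Zz _ mk)); apply: kink_null => //; exact: dF.
apply: aeS (aeI _ _ _ (aeI _ _ _ (QK z Zz) sub) (aeI _ _ _ kphi kpsi)).
move=> u [[QKu [phif subu]] [kphiu kpsiu]]; split => //; split => /=; rewrite ?QKu//.
- by rewrite ltey_eq phif.
- have -> : psi (Q (u, z), z) = conj (fun x => phi (x, z)) (Q (u, z)).
    by rewrite -psiE.
  exact: (subgrad_fenchel (fun x => phi (x, z))).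
Qed.

(** [FYZ z] is the image of [FU] under [Q (., z)], so the exceptional Borel set may be pulled back
    to [u]. *)
Lemma ae_smooth_FYZ z : Zs z -> {ae FYZ z, forall y, smooth (y, z)}.
Proof.
move=> Zz; have mS := measurable_smooth_section z.
exists (~` [set y | smooth (y, z)]); split => //; first exact: measurableC.
rewrite -pushQ//; last exact: measurableC.
apply: measure_negligible.
  have mQz : measurable_fun setT (fun u : Rv R d => Q (u, z) : Rv R d).
    by apply: (measurableT_comp mQ); exact: measurable_fun_pair.
  by rewrite -[X in measurable X]setTI; apply: mQz => //; exact: measurableC.
by apply: negligibleS (ae_smooth_FU z Zz) => u /= nS [].
Qed.

Lemma ae_smooth_P : {ae P, forall w, smooth (Y w, Z w)}.
Proof.
have mS := measurable_smooth.
exists [set w | (~` smooth) (Y w, Z w)]; split => //.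
  have mYZ : measurable_fun setT (fun w => (Y w, Z w)) by exact: measurable_fun_pair.
  by rewrite -[X in measurable X]setTI; apply: mYZ => //; exact: measurableC.
have mC := measurableC mS.
rewrite (disintegration P Y Z FYZ mY mZ mF hF)//.
rewrite (ae_eq_integral (cst 0%E))//; first by rewrite integral0.
- exact: measurable_disintegration.
- apply: aeS ZsZ => w Zw _ /=; apply: measure_negligible.
    by apply: measurableC; exact: measurable_smooth_section.
  exact: ae_smooth_FYZ.
Qed.

Definition rank w : Rv R d := Qinv (Y w, Z w).

Lemma measurable_rank : measurable_fun setT rank.
Proof. by apply: (measurableT_comp mQinv); exact: measurable_fun_pair. Qed.

(** Under [FYZ z] the variable [y] is distributed as [Q (u, z)] with [u] of law [FU], and [Qinv]
    recovers [u] almost surely. *)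
Lemma rank_feasible : primal_feasible P Z FU rank.
Proof.
split; first exact: measurable_rank.
move=> A B mA mB.
pose C := [set p : Rv R d * Rv R k | A (Qinv p) /\ B p.2].
have mC : measurable C.
  have -> : C = (Qinv : Rv R d * Rv R k -> Rv R d) @^-1` A `&` snd @^-1` B by [].
  apply: measurableI; rewrite -[X in measurable X]setTI; first exact: mQinv.
  exact: (@measurable_snd _ _ (Rv R d) (Rv R k)).
have -> : rank @^-1` A `&` Z @^-1` B = [set w | C (Y w, Z w)] by [].
rewrite (disintegration P Y Z FYZ mY mZ mF hF)// [RHS]integral_mkcond.
have mZB : measurable (Z @^-1` B) by rewrite -[X in measurable X]setTI; exact: mZ.
apply: ae_eq_integral => //.
- exact: measurable_disintegration.
- by apply/(measurable_restrictT _ mZB).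
apply: aeS ZsZ => w Zw _; rewrite patchE /C/=.
have [Bw|Bw] := pselect (B (Z w)); last first.
  rewrite (_ : mkset _ = set0) ?measure0; last by rewrite -subset0 => y [].
  by rewrite ifF//; apply/negbTE; rewrite notin_setE.
rewrite ifT ?inE//.
have mAz : measurable ([set y | A (Qinv (y, Z w))] : set (Rv R d)).
  have mq : measurable_fun setT (fun y : Rv R d => Qinv (y, Z w) : Rv R d).
    by apply: (measurableT_comp mQinv); exact: measurable_fun_pair.
  by rewrite -[X in measurable X]setTI; exact: mq.
rewrite (_ : mkset _ = [set y | A (Qinv (y, Z w))]); last first.
  by apply/seteqP; split => y //= [].
rewrite -pushQ//.
apply: ae_measure_eq => //.
  have mQz : measurable_fun setT (fun u : Rv R d => Q (u, Z w) : Rv R d).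
    by apply: (measurableT_comp mQ); exact: measurable_fun_pair.
  by rewrite -[X in measurable X]setTI; exact: mQz.
by apply: aeS (QK (Z w) Zw) => u /= ->.
Qed.

Section objective.
Variables phi' psi' : 'rV[R]_d * 'rV[R]_k -> \bar R.
Hypothesis df : dual_feasible Zs phi' psi'.

Lemma dual_feasible_ae V : {ae P, forall w,
  ((dotv (V w : 'rV[R]_d) (Y w))%:E <= phi' (V w, Z w) + psi' (Y w, Z w))%E}.
Proof. by case: df => _ _ _ _ H; apply: aeS ZsZ => w Zw; exact: H. Qed.

(** The dual constraint makes the inner products, integrable by the second moments, the lower bounds
    that [expectation_sum_le] asks for. Exchanging [V] and [V'] gives equality. *)
Lemma dual_sum_le V V' : primal_feasible P Z FU V -> primal_feasible P Z FU V' ->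
  (dual_obj P Y Z phi' psi' V <= dual_obj P Y Z phi' psi' V')%E.
Proof.
move=> fV fV'; case: (df) => mphi' mpsi' Ny _ _.
have mYZ : measurable_fun setT (fun w => (Y w, Z w)) by exact: measurable_fun_pair.
apply: (@expectation_sum_le _ _ _ _ _ P (fun w => (V' w, Z w)) (fun w => (V w, Z w)) phi'
  (fun w => psi' (Y w, Z w)) (fun w => (dotv (V' w : 'rV[R]_d) (Y w))%:E)
  (fun w => (dotv (V w : 'rV[R]_d) (Y w))%:E)).
- by apply: measurable_fun_pair => //; case: fV'.
- by apply: measurable_fun_pair => //; case: fV.
- by move=> C mC; apply: (feasible_joint_law P Z FU mZ).
- exact: mphi'.
- exact: (measurableT_comp mpsi' mYZ).
- by move=> p; have [] := Ny p.
- by move=> w; have [] := Ny (Y w, Z w).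
- exact: (feasible_dot_integrable P Z FU mZ).
- exact: (feasible_dot_integrable P Z FU mZ).
- exact: dual_feasible_ae.
- exact: dual_feasible_ae.
Qed.

Lemma measurable_dual_sum (V : Om -> Rv R d) : measurable_fun setT V ->
  measurable_fun setT (fun w => phi' (V w, Z w) + psi' (Y w, Z w))%E.
Proof.
case: df => mphi' mpsi' _ _ _ mV; apply: emeasurable_funD.
- apply: (measurableT_comp mphi'); exact: measurable_fun_pair.
- apply: (measurableT_comp mpsi'); exact: measurable_fun_pair.
Qed.

Lemma weak_duality V : primal_feasible P Z FU V ->
  (primal_obj P Y V <= dual_obj P Y Z phi' psi' V)%E.
Proof.
move=> fV; apply: le_integral_lower.
- by apply: measurable_dual_sum; case: fV.
- exact: (feasible_dot_integrable P Z FU mZ).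
- exact: dual_feasible_ae.
Qed.

End objective.

Lemma pair_dual_feasible : dual_feasible Zs phi psi.
Proof.
have [_ _ _ H] := pair; split => //.
  by move=> z /H[].
move=> z u y Zz; rewrite -[psi (y, z)]/((fun y => psi (y, z)) y) psiE//.
apply: (young (fun x => phi (x, z))) => //.
by rewrite -psiE.
Qed.

Lemma strong_duality V : primal_feasible P Z FU V ->
  primal_obj P Y rank = dual_obj P Y Z phi psi V.
Proof.
move=> fV; have df := pair_dual_feasible; have fU := rank_feasible.
transitivity (dual_obj P Y Z phi psi rank); last first.
  by apply/eqP; rewrite eq_le; apply/andP; split; exact: dual_sum_le.
apply: ae_eq_integral => //.
- by apply/measurable_EFinP; apply: measurable_dotv => //; exact: measurable_rank.
- by apply: measurable_dual_sum => //; exact: measurable_rank.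
- by apply: aeS ae_smooth_P => w [_ /= <- _ _] _.
Qed.

(** An optimal [V] attains equality in weak duality, so Fenchel's equality holds almost surely and
    [V] is a subgradient of [psi (., Z)] at [Y]. There [psi] is differentiable with gradient
    [rank]. *)
Lemma rank_unique V : primal_feasible P Z FU V ->
  (primal_obj P Y rank <= primal_obj P Y V)%E -> {ae P, forall w, V w = rank w}.
Proof.
move=> fV UV; have df := pair_dual_feasible; rewrite (strong_duality V fV) in UV.
have := @ae_eq_lower _ _ _ P (fun w => phi (V w, Z w) + psi (Y w, Z w))%E
  (fun w => (dotv (V w : 'rV[R]_d) (Y w))%:E) _ _ _ UV.
move=> H; have {}H := H (measurable_dual_sum _ _ df V fV.1)
  (feasible_dot_integrable P Z FU mZ Y V mY Y2 U2 fV) (dual_feasible_ae _ _ df V).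
apply: aeS (aeI _ _ _ H (aeI _ _ _ ae_smooth_P ZsZ)) => w [fen [sm Zw]].
have [gpsi _] := smooth_egrad _ _ Zw sm.
apply: (egrad_subgrad_unique _ _ _ _ gpsi).
have phif : phi (V w, Z w) \is a fin_num.
  rewrite fin_numElt phiNy/=; move: fen.
  by case: (phi (V w, Z w)) (psiNy (Y w, Z w)); case: (psi (Y w, Z w)) => //= *; rewrite ?ltry.
rewrite psiE//; apply: (fenchel_subgrad (fun x => phi (x, Z w))) => //.
by rewrite -psiE.
Qed.

End kantorovich.

(** * The product probability space *)

Section change_of_space.
Context {R : realType} {dO d1} {Om : measurableType dO} {T : measurableType d1}.
Variables (P : {measure set Om -> \bar R}) (P1 : {measure set T -> \bar R}) (pr : Om -> T).
Hypotheses (mpr : measurable_fun setT pr)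
  (prE : forall A, measurable A -> P (pr @^-1` A) = P1 A).

Lemma law_integral (D : set T) (g : T -> \bar R) : measurable D ->
  measurable_fun setT g -> (forall x, 0 <= g x)%E ->
  (\int[P]_(w in pr @^-1` D) g (pr w) = \int[P1]_(x in D) g x)%E.
Proof.
move=> mD mg g0.
have := @ge0_integral_pushforward _ _ _ _ _ pr mpr P D g mD (measurable_funTS mg).
move=> <-//; apply: (@eq_measure_integral _ _ _ _ P1 (pushm P mpr)) => A mA _.
by rewrite pushmE; exact: prE.
Qed.

Lemma law_ae (A : T -> Prop) : {ae P1, forall x, A x} -> {ae P, forall w, A (pr w)}.
Proof.
move=> [N [mN N0 sN]]; exists (pr @^-1` N); split.
- by rewrite -[X in measurable X]setTI; exact: mpr.
- by rewrite prE.
- by move=> w nA; exact: sN.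
Qed.

Lemma law_cond_law {n m} (Y : T -> Rv R n) (Z : T -> Rv R m)
    (K : 'rV[R]_m -> probability (Rv R n) R) :
  measurable_fun setT Y -> measurable_fun setT Z ->
  (forall A, measurable A -> measurable_fun setT (fun z : Rv R m => K z A)) ->
  cond_law P1 Y Z (fun z => K z) -> cond_law P (Y \o pr) (Z \o pr) (fun z => K z).
Proof.
move=> mY mZ mK hK A B mA mB.
have mYA : measurable (Y @^-1` A) by rewrite -[X in measurable X]setTI; exact: mY.
have mZB : measurable (Z @^-1` B) by rewrite -[X in measurable X]setTI; exact: mZ.
rewrite -[X in P X]/(pr @^-1` (Y @^-1` A `&` Z @^-1` B)) prE; last exact: measurableI.
rewrite hK// -law_integral//.
exact: (measurableT_comp (mK A mA) mZ).
Qed.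

End change_of_space.

Section unit_interval.
Context {R : realType}.

(** [Leb01] is a bare set function; its measure axioms are inherited from this restricted measure,
    with which it is convertible. *)
Let m : {measure set (measurableTypeR R) -> \bar R} :=
  mrestr lebesgue_measure (measurable_itv (`]0, 1[ : interval R)).

Let Leb01_0 : @Leb01 R set0 = 0%E. Proof. exact: (measure0 m). Qed.

Let Leb01_ge0 A : (0 <= @Leb01 R A)%E. Proof. exact: (measure_ge0 m). Qed.

Let Leb01_additive : semi_sigma_additive (@Leb01 R).
Proof. exact: (@measure_semi_sigma_additive _ _ _ m). Qed.

HB.instance Definition _ :=
  isMeasure.Build _ _ _ (@Leb01 R) Leb01_0 Leb01_ge0 Leb01_additive.

Let Leb01_setT : @Leb01 R setT = 1%E.
Proof. by rewrite /Leb01 setTI lebesgue_measure_itv/= lte_fin ltr01 sube0. Qed.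

HB.instance Definition _ := Measure_isProbability.Build _ _ _ (@Leb01 R) Leb01_setT.

End unit_interval.

Definition product_prob {R : realType} {d0 d1} {T0 : measurableType d0}
    {T1 : measurableType d1} (P0 : probability T0 R) (P1 : probability T1 R) :
    probability ((T0 * T1) * R)%type R := ((P0 \x P1) \x (@Leb01 R))%E.

Lemma product_prob_middle {R : realType} {d0 d1} {T0 : measurableType d0}
    {T1 : measurableType d1} (P0 : probability T0 R) (P1 : probability T1 R) A :
  measurable A -> product_prob P0 P1 ((fun w => w.1.2) @^-1` A) = P1 A.
Proof.
move=> mA; have -> : (fun w : (T0 * T1) * R => w.1.2) @^-1` A = (setT `*` A) `*` setT.
  by apply/seteqP; split => w //= [[]].
rewrite [LHS]product_measure1E//; last exact: measurableX.
by rewrite [X in (X * _)%E]product_measure1E//= [P0 _]probability_setT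
  [Leb01 _]probability_setT mul1e mule1.
Qed.

(** A null neighbourhood [B] of [z] would make the whole cylinder over [B] null. The conjugacy
    relations, known for every [u] once [z] is in [Zs], therefore cover [UZs]. *)
Lemma supp2_prod_snd {R : realType} {n m d} {T : measurableType d} (P1 : probability T R)
    (Z : T -> Rv R m) (mu : probability (Rv R n) R) u z :
  supp2 ((mu \x (fun B => P1 (Z @^-1` B)))%E) (u, z) -> supp (fun B => P1 (Z @^-1` B)) z.
Proof.
move=> uz B oB Bz; have := uz (snd @^-1` B).
have oS : open ((snd : 'rV[R]_n * 'rV[R]_m -> 'rV[R]_m) @^-1` B).
  by apply: open_comp => // p _; exact: cvg_snd.
move=> /(_ oS Bz); rewrite !lt_neqAle !measure_ge0 !andbT => /andP[+ _].
apply: contra => /eqP PB; apply/eqP/esym; rewrite /product_measure1.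
rewrite (eq_integral (cst 0%E)) ?integral0// => x _ /=.
rewrite (_ : xsection _ _ = B) -?PB//.
by apply/seteqP; split => y; rewrite /xsection/= inE.
Qed.

Lemma supp2_joint_snd {R : realType} {n m d} {T : measurableType d} (P1 : probability T R)
    (Y : T -> Rv R n) (Z : T -> Rv R m) y z :
  supp2 (fun A => P1 ((fun w => (Y w, Z w)) @^-1` A)) (y, z) ->
  supp (fun B => P1 (Z @^-1` B)) z.
Proof.
move=> yz B oB Bz; apply: (yz (snd @^-1` B)) => //.
by apply: open_comp => // p _; exact: cvg_snd.
Qed.

Theorem theorem2p3 (R : realType) (d k : nat)
  (d0 d1 : measure_display) (T0 : measurableType d0) (T1 : measurableType d1)
  (P0 : probability T0 R) (P1 : probability T1 R)
  (Y : T1 -> Rv R d) (Z : T1 -> Rv R k)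
  (FU : probability (Rv R d) R)
  (FYZ : 'rV[R]_k -> probability (Rv R d) R)
  (lam : {measure set (Rv R d) -> \bar R})
  (Q Qinv : 'rV[R]_d * 'rV[R]_k -> 'rV[R]_d) :
  let Zs := supp (fun B => P1 (Z @^-1` B)) in
  let UZs := supp2 ((FU \x (fun B => P1 (Z @^-1` B)))%E) in
  let YZs := supp2 (fun A => P1 ((fun w => (Y w, Z w)) @^-1` A)) in
  let P := prodP P0 P1 in
  let Yw := fun w : (T0 * T1) * R => Y w.1.2 in
  let Zw := fun w : (T0 * T1) * R => Z w.1.2 in
  measurable_fun setT Y -> measurable_fun setT Z ->
  (* the first factor carries a random vector with law FU *)
  (exists U0 : T0 -> Rv R d, measurable_fun setT U0 /\
     forall A, measurable A -> P0 (U0 @^-1` A) = FU A) ->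
  (* FYZ is a regular conditional distribution of Y given Z *)
  (forall A, measurable A -> measurable_fun setT (fun z : Rv R k => FYZ z A)) ->
  cond_law P1 Y Z (fun z => FYZ z) ->
  (* lam is Lebesgue measure on R^d *)
  is_lebesgue_Rn lam ->
  (* (N) *)
  has_density lam FU -> convex_set (supp FU : set (convex_lmodType 'rV[R]_d)) ->
  (* (C) *)
  (forall z, Zs z -> has_density lam (FYZ z)) ->
  (* (M) *)
  (\int[P1]_w (sqnorm (Y w))%:E < +oo)%E ->
  (\int[FU]_u (sqnorm (u : 'rV[R]_d))%:E < +oo)%E ->
  (* conditional vector quantile and rank functions *)
  measurable_fun setT (Q : Rv R d * Rv R k -> Rv R d) ->
  measurable_fun setT (Qinv : Rv R d * Rv R k -> Rv R d) ->
  cond_vquantile FU (fun z => FYZ z) Zs Q ->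
  (forall z, Zs z -> {ae FU, forall u, Qinv (Q (u, z), z) = u}) ->
  exists phi psi : 'rV[R]_d * 'rV[R]_k -> \bar R,
    [/\ (* (a) *)
        [/\ dual_feasible Zs phi psi,
            (forall phi' psi', dual_feasible Zs phi' psi' ->
               forall V V', primal_feasible P Zw FU V -> primal_feasible P Zw FU V' ->
               (dual_obj P Yw Zw phi psi V <= dual_obj P Yw Zw phi' psi' V')%E),
            (forall z, Zs z -> econvex (fun u => phi (u, z)) /\
                               econvex (fun y => psi (y, z))),
            (forall u z, UZs (u, z) ->
               phi (u, z) = ereal_sup [set ((dotv u y)%:E - psi (y, z))%E | y in setT]) &
            (forall y z, YZs (y, z) ->
               psi (y, z) = ereal_sup [set ((dotv u y)%:E - phi (u, z))%E | u in setT])],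
        (* (b) *)
        (forall z, Zs z -> {ae FU, forall u, egrad (fun u' => phi (u', z)) u (Q (u, z))}),
        (* (c) *)
        (forall z, Zs z ->
           {ae FYZ z, forall y, egrad (fun y' => psi (y', z)) y (Qinv (y, z))}),
        (* (d) *)
        (let U := fun w => Qinv (Yw w, Zw w) : Rv R d in
         [/\ primal_feasible P Zw FU U,
             (forall V, primal_feasible P Zw FU V ->
                (primal_obj P Yw V <= primal_obj P Yw U)%E),
             (forall V, primal_feasible P Zw FU V ->
                (primal_obj P Yw U <= primal_obj P Yw V)%E ->
                {ae P, forall w, V w = U w}) &
             (forall V, primal_feasible P Zw FU V ->
                primal_obj P Yw U = dual_obj P Yw Zw phi psi V)]) &
        (* (e) *)
        (forall z, Zs z ->
           {ae FU, forall u, exists g, egrad (fun u' => phi (u', z)) u g /\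
                                       egrad (fun y' => psi (y', z)) g u} /\
           {ae FYZ z, forall y, exists g, egrad (fun y' => psi (y', z)) y g /\
                                          egrad (fun u' => phi (u', z)) g y})].
Proof.
move=> Zs UZs YZs P Yw Zw mY mZ _ mF hF lamE dU _ dF Y2 U2 mQ mQinv hQ QK.
have mZs : measurable (Zs : set (Rv R k)) by exact: measurable_supp.
have [|phi [psi pair]] := potential_pair_exists FU Q Zs mQ mZs.
  by move=> z /hQ[f [fNy fc fQ _]]; exists f.
exists phi, psi.
(* The bundled probability convertible with [P]; results proved for [Pm] close the goals stated with
   [P]. *)
pose Pm := product_prob P0 P1.
pose pr := fun w : (T0 * T1) * R => w.1.2.
have mpr : measurable_fun setT pr.
  exact: (measurableT_comp measurable_snd measurable_fst).
have prE A : measurable A -> Pm (pr @^-1` A) = P1 A by exact: product_prob_middle.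
have mYw : measurable_fun setT Yw by exact: (measurableT_comp mY mpr).
have mZw : measurable_fun setT Zw by exact: (measurableT_comp mZ mpr).
have hFw : cond_law Pm Yw Zw (fun z => FYZ z) by exact: law_cond_law hF.
have Y2w : (\int[Pm]_w (sqnorm (Yw w : 'rV[R]_d))%:E < +oo)%E.
  have := law_integral Pm P1 pr mpr prE setT (fun x => (sqnorm (Y x : 'rV[R]_d))%:E) measurableT.
  rewrite preimage_setT => ->//.
    by apply/measurable_EFinP; exact: measurable_sqnorm.
  by move=> x; rewrite lee_fin; apply: sumr_ge0 => i _; exact: sqr_ge0.
have ZsZ : {ae Pm, forall w, Zs (Zw w)}.
  apply: (law_ae Pm P1 pr mpr prE (fun x => Zs (Z x))).
  exact: (law_ae P1 (pushm P1 mZ) Z mZ (fun A _ => erefl) Zs (negligible_suppC (pushm P1 mZ))).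
have pushQ z : Zs z -> forall A : set (Rv R d), measurable A ->
    FU ((fun u => Q (u, z)) @^-1` A) = FYZ z A.
  by move=> /hQ[f [_ _ _ +]].
pose U w : Rv R d := Qinv (Yw w, Zw w).
have df : dual_feasible Zs phi psi by exact: pair_dual_feasible pair.
have fU : primal_feasible Pm Zw FU U.
  exact: (rank_feasible Pm Yw Zw FU FYZ Q Qinv Zs).
have SD V : primal_feasible Pm Zw FU V -> primal_obj Pm Yw U = dual_obj Pm Yw Zw phi psi V.
  exact: (strong_duality Pm Yw Zw FU FYZ lam Q Qinv Zs).
have WD phi' psi' V : dual_feasible Zs phi' psi' -> primal_feasible Pm Zw FU V ->
    (primal_obj Pm Yw V <= dual_obj Pm Yw Zw phi' psi' V)%E.
  by move=> df' fV; exact: (weak_duality Pm Yw Zw FU Zs).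
have smU z : Zs z -> {ae FU, forall u, egrad (fun u' => phi (u', z)) u (Q (u, z)) /\
    egrad (fun y' => psi (y', z)) (Q (u, z)) u}.
  move=> Zz.
  have := ae_smooth_FU FU FYZ lam Q Qinv Zs phi psi lamE dU dF mQ pushQ QK pair z Zz.
  apply: aeS => u [sm QKu].
  by have := smooth_egrad FU Q Qinv Zs phi psi pair z _ Zz sm; rewrite QKu => -[].
have smY z : Zs z -> {ae FYZ z, forall y, egrad (fun y' => psi (y', z)) y (Qinv (y, z)) /\
    egrad (fun u' => phi (u', z)) (Qinv (y, z)) y}.
  move=> Zz.
  have := ae_smooth_FYZ FU FYZ lam Q Qinv Zs phi psi lamE dU dF mQ mQinv pushQ QK pair z Zz.
  by apply: aeS => y; exact: (smooth_egrad FU Q Qinv Zs phi psi pair z y Zz).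
have [_ _ _ H] := pair.
split.
- split => //.
  + move=> phi' psi' df' V V' fV fV'.
    (* The value of [(phi, psi)] is the primal value of [U], hence below the competitor's objective
       at [U], which equals its objective at [V']. *)
    rewrite -[X in (X <= _)%E]SD//; apply: (le_trans (WD _ _ _ df' fU)).
    exact: (dual_sum_le Pm Yw Zw FU Zs).
  + by move=> z /H[].
  + move=> u z /supp2_prod_snd /H[-> _ _ _ _]; congr ereal_sup.
    by apply/seteqP; split => _ [y _ <-]; exists y => //=; rewrite dotvC.
  + by move=> y z /supp2_joint_snd /H[_ /(_ y)].
- by move=> z /smU; apply: aeS => u [].
- by move=> z /smY; apply: aeS => y [].
- split => //.
  + by move=> V fV; rewrite (SD V fV); exact: WD.
  + move=> V fV UV.
    exact: (rank_unique Pm Yw Zw FU FYZ lam Q Qinv Zs phi psi).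
- move=> z Zz; split.
  + by apply: aeS (smU z Zz) => u; exists (Q (u, z)).
  + by apply: aeS (smY z Zz) => y; exists (Qinv (y, z)).
Qed.
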